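(* Let $n\ge1$, $\alpha\in[0,n)$, and let $V$ be a finite positive measure on $\mathbb{R}^n$ that is absolutely continuous with respect to Lebesgue measure. Suppose $\Omega$ is a homogeneous function of degree zero on $\mathbb{R}^n\setminus\{0\}$ satisfying the $L^{\frac{n}{n-\alpha}}$-Dini condition. If $M^{\alpha}_{\Omega}$ is bounded from $L^1(\mathbb{R}^n)$ to $L^{\frac{n}{n-\alpha},\infty}(\mathbb{R}^n)$, then: (1) $\frac{\Omega(x)}{|x|^{n-\alpha}}\in L^{\frac{n}{n-\alpha},\infty}$ and $\big\|\frac{\Omega(\cdot)}{|\cdot|^{n-\alpha}}\big\|_{L^{\frac{n}{n-\alpha},\infty}}\le C\|M^{\alpha}_{\Omega}\|_{L^1\to L^{\frac{n}{n-\alpha},\infty}}$; (2) $\Omega\in L^{\frac{n}{n-\alpha}}(\mathbb{S}^{n-1})$ and $\|\Omega\|_{L^{\frac{n}{n-\alpha}}(\mathbb{S}^{n-1})}\le C\|M^{\alpha}_{\Omega}\|_{L^1\to L^{\frac{n}{n-\alpha},\infty}}$; (3) for every $\rho>0$, $$\lim_{t\to0^+}\Big\|M^{\alpha}_{\Omega}(V_t)-\frac{|\Omega(\cdot)|}{|\cdot|^{n-\alpha}}V(\mathbb{R}^n)\Big\|_{L^{\frac{n}{n-\alpha},\infty}(\mathbb{R}^n\setminus B(0,\rho))}=0,$$ where $C$ depends only on $n,\alpha$.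
   Context: $\Omega$ homogeneous of degree zero: $\Omega(sx)=\Omega(x)$ for $s>0$, $x\ne0$. For $1\le q<\infty$, $0\le s<n$, the $L^q_s$-Dini condition means $\Omega\in L^q(\mathbb{S}^{n-1})$ and $\int_0^1\frac{\omega_q(t)}{t^{1+s}}dt<\infty$, with $\omega_q(t)=\big(\sup_{|h|\le t}\int_{\mathbb{S}^{n-1}}|\Omega(x'+h)-\Omega(x')|^q d\sigma(x')\big)^{1/q}$; the $L^q$-Dini condition is the $L^q_0$-Dini condition. $M^{\alpha}_{\Omega}\mu(x)=\sup_{r>0}r^{-(n-\alpha)}\int_{B(x,r)}|\Omega(x-y)|\,d\mu(y)$ for positive measures $\mu$ (for functions $f$, $d\mu=|f|dy$). $V_t(E)=V(E/t)$. For a measurable set $E$, $\|f\|_{L^{p,\infty}(E)}=\sup_{\lambda>0}\lambda|\{x\in E:|f(x)|>\lambda\}|^{1/p}$. *)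

(* Defs.v *)
From HB Require Import structures.
From mathcomp Require Import all_boot all_order all_algebra.
From mathcomp Require Import all_classical all_reals all_analysis.
Set Implicit Arguments. Unset Strict Implicit. Unset Printing Implicit Defensive.
Import Order.TTheory GRing.Theory Num.Theory.
Import numFieldNormedType.Exports.
Local Open Scope classical_set_scope.
Local Open Scope ring_scope.

Record mspace (R : realType) := MSpace {
  msd : measure_display; msT : measurableType msd;
  msmu : {measure set msT -> \bar R} }.

Fixpoint lebR (R : realType) (k : nat) : mspace R :=
  match k with
  | 0 => @MSpace R _ (measurableTypeR R) (@lebesgue_measure R)
  | k.+1 => let s := lebR R k in
     @MSpace R _ (msT s * measurableTypeR R)%type
        ((msmu s) \x (@lebesgue_measure R))%E
  end.

Fixpoint coords (R : realType) (k : nat) : msT (lebR R k) -> nat -> R :=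
  match k return msT (lebR R k) -> nat -> R with
  | 0 => fun x i => if i == 0%N then x else 0
  | k.+1 => fun p i => if (i <= k)%N then coords p.1 i
                      else if i == k.+1 then p.2 else 0
  end.

Definition Rn (R : realType) (n : nat) : Type := 'rV[R]_n.

Section Rn_structure.
Context (R : realType) (n : nat).
HB.instance Definition _ := GRing.Zmodule.on (Rn R n).
HB.instance Definition _ := GRing.Lmodule.on (Rn R n).
HB.instance Definition _ := isPointed.Build (Rn R n) 0.

Definition vec : msT (lebR R n.-1) -> Rn R n :=
  fun x => \row_(i < n) coords x i.

Definition Rn_measurable (A : set (Rn R n)) : Prop :=
  measurable (vec @^-1` A).

Lemma Rn_measurable0 : Rn_measurable set0.
Proof. by rewrite /Rn_measurable preimage_set0; exact: measurable0. Qed.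

Lemma Rn_measurableC A : Rn_measurable A -> Rn_measurable (~` A).
Proof. by rewrite /Rn_measurable preimage_setC; exact: measurableC. Qed.

Lemma Rn_measurable_bigcup (F : (set (Rn R n))^nat) :
  (forall i, Rn_measurable (F i)) -> Rn_measurable (\bigcup_i F i).
Proof. by move=> mF; rewrite /Rn_measurable preimage_bigcup; exact: bigcupT_measurable. Qed.

HB.instance Definition _ := @isMeasurable.Build default_measure_display (Rn R n)
  Rn_measurable Rn_measurable0 Rn_measurableC Rn_measurable_bigcup.

Definition leb : set (Rn R n) -> \bar R := pushforward (msmu (lebR R n.-1)) vec.

Lemma leb0 : leb set0 = 0%E.
Proof. by rewrite /leb /pushforward preimage_set0 measure0. Qed.

Lemma leb_ge0 A : (0 <= leb A)%E.
Proof. by rewrite /leb /pushforward; exact: measure_ge0. Qed.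

Lemma leb_sigma_additive : semi_sigma_additive leb.
Proof.
move=> F mF tF mUF; rewrite /leb /pushforward preimage_bigcup.
apply: measure_semi_sigma_additive => //.
- apply/trivIsetP => /= i j _ _ ij; rewrite -preimage_setI.
  by move/trivIsetP : tF => /(_ _ _ _ _ ij) ->//; rewrite preimage_set0.
Qed.

HB.instance Definition _ := isMeasure.Build _ _ _ leb leb0 leb_ge0 leb_sigma_additive.
End Rn_structure.


Section harmonic_analysis_defs.
Context (R : realType) (n : nat).
Local Open Scope ereal_scope.

Definition enorm (x : Rn R n) : R :=
  Num.sqrt (\sum_(i < n) ((x : 'rV[R]_n) ord0 i) ^+ 2).

Definition eball (x : Rn R n) (r : R) : set (Rn R n) :=
  [set y | (enorm (y - x) < r)%R].

Definition normalize (x : Rn R n) : Rn R n := ((enorm x)^-1 *: x)%R.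

(* integral over S^{n-1} w.r.t. surface measure sigma, via the polar formula
   sigma(A) = n * |{ r x' : x' in A, 0 < r <= 1 }|  (cone measure) *)
Definition sph_int (g : Rn R n -> \bar R) : \bar R :=
  (n%:R)%:E * \int[@leb R n]_(x in eball (0%R : Rn R n) 1%R `\ (0%R : Rn R n)) g (normalize x).

Definition homogeneous0 (Om : Rn R n -> R) : Prop :=
  forall (s : R) (x : Rn R n), (0 < s)%R -> x != 0%R -> Om (s *: x) = Om x.

Definition in_Lq_sphere (q : R) (Om : Rn R n -> R) : Prop :=
  measurable_fun (eball (0%R : Rn R n) 1%R `\ (0%R : Rn R n)) (Om \o normalize) /\
  sph_int (fun y => (`|Om y| `^ q)%:E) < +oo.

Definition Lq_sphere_norm (q : R) (Om : Rn R n -> R) : \bar R :=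
  sph_int (fun y => (`|Om y| `^ q)%:E) `^ q^-1.

Definition omega_q (q : R) (Om : Rn R n -> R) (t : R) : \bar R :=
  ereal_sup [set sph_int (fun y => (`|Om (y + h) - Om y| `^ q)%:E)
            | h in [set h : Rn R n | (enorm h <= t)%R]] `^ q^-1.

Definition Lqs_Dini (q s : R) (Om : Rn R n -> R) : Prop :=
  in_Lq_sphere q Om /\
  \int[@lebesgue_measure R]_(t in `]0%R, 1%R]%classic)
     (omega_q q Om t * ((t `^ (1 + s))^-1)%:E) < +oo.

Definition Lq_Dini (q : R) (Om : Rn R n -> R) : Prop := Lqs_Dini q 0 Om.

Definition Mmeas (alpha : R) (Om : Rn R n -> R) (mu : set (Rn R n) -> \bar R)
  (x : Rn R n) : \bar R :=
  ereal_sup [set (r `^ (- (n%:R - alpha)))%:E *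
                 \int[mu]_(y in eball x r) (`|Om (x - y)|)%:E
            | r in [set r : R | (0 < r)%R]].

Definition Mfun (alpha : R) (Om : Rn R n -> R) (f : Rn R n -> R)
  (x : Rn R n) : \bar R :=
  ereal_sup [set (r `^ (- (n%:R - alpha)))%:E *
                 \int[@leb R n]_(y in eball x r) (`|Om (x - y)| * `|f y|)%:E
            | r in [set r : R | (0 < r)%R]].

Definition weak_norm (p : R) (E : set (Rn R n)) (F : Rn R n -> \bar R) : \bar R :=
  ereal_sup [set lam%:E * (@leb R n (E `&` [set x | lam%:E < `|F x|]) `^ p^-1)
            | lam in [set lam : R | (0 < lam)%R]].

Definition L1norm (f : Rn R n -> R) : \bar R := \int[@leb R n]_x (`|f x|)%:E.

Definition M_opnorm (alpha : R) (Om : Rn R n -> R) : \bar R :=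
  ereal_inf [set A%:E | A in [set A : R | (0 <= A)%R /\
     forall f : Rn R n -> R, measurable_fun setT f -> L1norm f < +oo ->
       weak_norm (n%:R / (n%:R - alpha)) setT (Mfun alpha Om f)
         <= A%:E * L1norm f]].

Definition dilate (V : set (Rn R n) -> \bar R) (t : R) : set (Rn R n) -> \bar R :=
  fun E => V [set y | (t *: y)%R \in E].

End harmonic_analysis_defs.

(* Main.v *)
(** For x outside B(0, rho) and a measure mu of mass m concentrated in a tiny
    ball B(0, eps), only radii r > |x| - eps matter in M mu (x), so M mu (x) lies
    between (|x| + eps)^-a and (|x| - eps)^-a times the integral of |Om (x - y)|
    d mu (y), where a = n - alpha and q = n / a.  Replacing |Om (x - y)| by |Om x|
    costs |x|^-a times the integral of |Om (x - y) - Om x| d mu (y); its weak L^q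
    norm is controlled by Chebyshev's inequality and by the integral over
    |x| >= rho of |x|^-n |Om (x - y) - Om x|^q, which splits into dyadic shells,
    each bounded by the L^q modulus of continuity of Om on the sphere at scale
    |y| / (2^k rho).  The Dini condition makes the sum over k small.  The part of
    V_t outside B(0, eps) has small mass and, having a density, is handled by the
    L^1 to weak L^q bound of M; this gives (3).  Applying (3) to the normalised
    restriction of Lebesgue measure to a unit cube and letting rho -> 0 gives (1),
    and (2) follows because |{|x| < tau (x)}| is comparable to the integral of
    tau^n over the unit ball for tau homogeneous of degree zero. *)
Require Import Defs.
From HB Require Import structures.
From mathcomp Require Import all_boot all_order all_algebra.
From mathcomp Require Import all_classical all_reals all_analysis.
From mathcomp Require Import measurable_realfun ring lra.
Import Order.TTheory GRing.Theory Num.Theory.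
Import numFieldNormedType.Exports.
Local Open Scope classical_set_scope.
Local Open Scope ring_scope.
Set Implicit Arguments.
Unset Strict Implicit.
Unset Printing Implicit Defensive.

(** * Lebesgue measure on R^n *)

(** Surface measure is given by cones in the unit ball. Accordingly, every passage between the
    sphere and R^n uses Tonelli on R^n x R and the substitution w = s z at fixed s instead of polar
    coordinates, at the price of constants such as powers of 2 and 4. Two kinds of bounds must be
    kept apart. The weak L^q size of the kernel is finite from the start, because Om is in L^q of
    the sphere; this finiteness only serves to choose small parameters in the limit (3). The
    constant C depends on n and alpha alone, and comes from measures of mass 1 that shrink to a
    point: their maximal functions have weak norm at most the operator bound and approach the kernel
    away from the origin. Since the weak quasi-norm is not subadditive, estimates are stated for
    distribution functions, and levels are split into halves or thirds. *)

Section image_measure.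
Context d d' (T1 : measurableType d) (T2 : measurableType d') (R : realType).
Variables (m : {measure set T1 -> \bar R}) (f : T1 -> T2).
Hypothesis mf : measurable_fun [set: T1] f.

(** The proof of measurability is an argument, so that the measure structure declared below can be
    inferred from the term itself. *)
Definition image_measure of measurable_fun [set: T1] f : set T2 -> \bar R :=
  pushforward m f.

Let image_measure0 : image_measure mf set0 = 0%E.
Proof. by rewrite /image_measure /pushforward preimage_set0 measure0. Qed.

Let image_measure_ge0 A : (0 <= image_measure mf A)%E.
Proof. exact: measure_ge0. Qed.

Let image_measure_sigma_additive : semi_sigma_additive (image_measure mf).
Proof.
move=> F mF tF mUF; rewrite /image_measure /pushforward preimage_bigcup.
apply: measure_semi_sigma_additive.
- by move=> n; rewrite -[X in measurable X]setTI; exact: mf.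
- apply/trivIsetP => /= i j _ _ ij; rewrite -preimage_setI.
  by move/trivIsetP : tF => /(_ _ _ _ _ ij) ->//; rewrite preimage_set0.
- by rewrite -preimage_bigcup -[X in measurable X]setTI; exact: mf.
Qed.

HB.instance Definition _ := isMeasure.Build _ _ _
  (image_measure mf) image_measure0 image_measure_ge0 image_measure_sigma_additive.

End image_measure.
Arguments image_measure {d d' T1 T2 R} m {f} mf.

Section lebesgue_scaling.
Context (R : realType).

(** By uniqueness of Lebesgue measure it is enough to test half-open intervals. *)
Lemma lebesgue_measure_scale (s : R) (A : set R) : 0 < s ->
  measurable (A : set (measurableTypeR R)) ->
  (s%:E * lebesgue_measure ((fun x => s * x)%R @^-1` A) = lebesgue_measure A)%E.
Proof.
move=> s0 mA.
have ms : measurable_fun setT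
    (fun x : measurableTypeR R => (s * x : measurableTypeR R)).
  exact: mulrl_measurable.
pose s' : {nonneg R} := NngNum (ltW s0).
apply/esym; apply: (@lebesgue_measure_unique R
  (mscale s' (image_measure (@lebesgue_measure R) ms))) => //.
move=> X /ocitvP [->|[[a b] /= ab ->]]; first by rewrite !measure0.
rewrite /mscale /= /image_measure /pushforward.
rewrite (_ : _ @^-1` _ = `](a/s), (b/s)]%classic); last first.
  by apply/seteqP; split=> x /=; rewrite !in_itv /= ltr_pdivrMr// ler_pdivlMr// (mulrC x s).
have ab' : a / s < b / s by rewrite ltr_pM2r // invr_gt0.
rewrite !lebesgue_measure_itv /= !lte_fin ab ab'.
rewrite -!EFinB -EFinM; congr (_%:E).
by rewrite -mulrBl mulrC divfK // gt_eqF.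
Qed.

End lebesgue_scaling.

(** * Iterated products of the line *)

Section lebR_theory.
Context (R : realType).

(** A name for the measure of [lebR R k], to which the sigma-finiteness needed by Tonelli's theorem
    can be attached. *)
Definition lebm (k : nat) : set (msT (lebR R k)) -> \bar R := msmu (lebR R k).

Arguments lebm k _ : clear implicits.

HB.instance Definition _ k := Measure.on (lebm k).

Lemma lebm_sigma_finite k : sigma_finite setT (lebm k).
Proof.
elim: k => [|k IH]; first exact: sigma_finiteT.
have /sigma_finiteP[F [TF ndF Foo]] := IH.
have /sigma_finiteP[G [TG ndG Goo]] := sigma_finiteT (@lebesgue_measure R).
exists (fun n => F n `*` G n).
  rewrite -setXTT TF TG predeqE => -[x y]; split.
    (* Both exhaustions increase, so a point caught at indices n and m is caught at their
       maximum. *)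
    move=> [/= [n _ Fnx] [m _ Gky]]; exists (maxn n m) => //; split.
    - by move: x Fnx; exact/subsetPset/ndF/leq_maxl.
    - by move: y Gky; exact/subsetPset/ndG/leq_maxr.
  by move=> [n _ []/= ? ?]; split; exists n.
move=> j; have [? ?] := Foo j; have [? ?] := Goo j.
split; first exact: measurableX.
rewrite [X in (X < _)%E](@product_measure1E _ _ _ _ _ (lebm k) (@lebesgue_measure R))//.
by rewrite lte_mul_pinfty// ge0_fin_numE.
Qed.

HB.instance Definition _ k :=
  Measure_isSigmaFinite.Build _ _ _ (lebm k) (lebm_sigma_finite k).

Fixpoint uncoords (k : nat) : (nat -> R) -> msT (lebR R k) :=
  match k with
  | 0 => fun f => f 0%N
  | k.+1 => fun f => (uncoords k f, f k.+1)
  end.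

Arguments uncoords k _ : clear implicits.

Lemma coords_uncoords k (f : nat -> R) i : (i <= k)%N ->
  coords (uncoords k f) i = f i.
Proof.
elim: k i => [|k IH] i /=; first by rewrite leqn0 => /eqP ->.
rewrite leq_eqVlt => /predU1P[->|]; first by rewrite ltnn eqxx.
by rewrite ltnS => ik; rewrite ik IH.
Qed.

Lemma eq_uncoords k (f g : nat -> R) : (forall i, (i <= k)%N -> f i = g i) ->
  uncoords k f = uncoords k g.
Proof.
elim: k => [|k IH] fg /=; first exact: fg.
by congr pair; [apply: IH => i ik; apply: fg; exact: leqW|exact: fg].
Qed.

Lemma uncoordsK k (x : msT (lebR R k)) : uncoords k (coords x) = x.
Proof.
elim: k x => [|k IH] //= [x y] /=.
rewrite ltnn eqxx; congr pair; rewrite -[RHS]IH.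
by apply: eq_uncoords => i ->.
Qed.

Lemma measurable_coords k i :
  measurable_fun setT (fun x : msT (lebR R k) => coords x i : R).
Proof.
elim: k i => [|k IH] i /=.
  by case: (i == 0)%N; [exact: measurable_id|exact: measurable_cst].
case: (i <= k)%N; first exact: (measurableT_comp (IH i) measurable_fst).
case: (i == k.+1); last exact: measurable_cst.
exact: measurable_snd.
Qed.

Lemma measurable_uncoords d (T : measurableType d) k (f : T -> nat -> R) :
  (forall i, (i <= k)%N -> measurable_fun setT (fun x => f x i)) ->
  measurable_fun setT (fun x => uncoords k (f x)).
Proof.
elim: k => [|k IH] mf /=; first exact: mf.
apply: measurable_fun_pair; last exact: mf.
by apply: IH => i ik; apply: mf; rewrite leqW.
Qed.

Definition dil (k : nat) (s : R) (x : msT (lebR R k)) : msT (lebR R k) :=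
  uncoords k (fun i => s * coords x i).

Arguments dil k s x : clear implicits.

Lemma measurable_dil (k : nat) (s : R) : measurable_fun setT (dil k s).
Proof.
apply: measurable_uncoords => i _.
by apply: measurable_funM => //; exact: measurable_coords.
Qed.

Lemma dilS k s (p : msT (lebR R k.+1)) : dil k.+1 s p = (dil k s p.1, s * p.2).
Proof.
case: p => x y; rewrite /dil /= ltnn eqxx; congr pair.
by apply: eq_uncoords => i ->.
Qed.

(** Induction on the dimension: rectangles determine the product measure, and on a rectangle the
    last coordinate contributes one more factor s. *)
Lemma lebm_dil k (s : R) (A : set (msT (lebR R k))) : 0 < s -> measurable A ->
  ((s ^+ k.+1)%:E * lebm k (dil k s @^-1` A) = lebm k A)%E.
Proof.
move=> s0; elim: k A => [|k IH] A mA.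
  by rewrite expr1; exact: lebesgue_measure_scale.
pose s' : {nonneg R} := NngNum (exprn_ge0 k.+2 (ltW s0)).
pose m' := mscale s' (image_measure (lebm k.+1) (@measurable_dil k.+1 s)).
apply/esym; apply: (@product_measure_unique _ _ _ _ R (lebm k)
  (@lebesgue_measure R) m') => // B D mB mD.
transitivity ((s ^+ k.+2)%:E *
    lebm k.+1 ((dil k s @^-1` B) `*` (( *%R s) @^-1` D)))%E.
  rewrite /m' /mscale; congr (_ * lebm k.+1 _)%E.
  by apply/seteqP; split=> p; rewrite /preimage /setX /mkset dilS.
rewrite [X in (_ * X)%E](@product_measure1E _ _ _ _ _ (lebm k) (@lebesgue_measure R))//; last 2 first.
  by rewrite -[X in measurable X]setTI; exact: measurable_dil.
  by rewrite -[X in measurable X]setTI; exact: mulrl_measurable.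
rewrite exprSr EFinM muleACA; congr (_ * _)%E; first exact: IH.
exact: lebesgue_measure_scale.
Qed.

End lebR_theory.
Arguments lebm {R} k _.
Arguments uncoords {R} k _.
Arguments dil {R} k s x.

(** * Row vectors and the Euclidean norm *)

Section Rn_theory.
Context (R : realType) (n : nat).
Notation Rn := (Rn R n.+1).
Notation leb := (@leb R n.+1).
Implicit Types x y : Rn.

(** The inverse of [vec]. The sigma-algebra and the measure of [Rn] are defined through [vec], so
    facts about iterated products are transported along this bijection. *)
Definition unvec x : msT (lebR R n) := uncoords n (fun i => x ord0 (inord i)).

Lemma unvecK x : @vec R n.+1 (unvec x) = x.
Proof.
apply/rowP => i; rewrite mxE coords_uncoords -1?ltnS ?ltn_ord//.
by rewrite inord_val.
Qed.

Lemma vecK (z : msT (lebR R n)) : unvec (@vec R n.+1 z) = z.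
Proof.
rewrite -[RHS]uncoordsK; apply: eq_uncoords => i ik.
by rewrite mxE inordK.
Qed.

Lemma measurable_vec : measurable_fun setT (@vec R n.+1).
Proof. by move=> _ Y mY; rewrite setTI. Qed.

Lemma measurable_coord i : measurable_fun setT (fun x => x ord0 i : R).
Proof.
move=> _ B mB; rewrite setTI.
suff : measurable (@vec R n.+1 @^-1` [set x : Rn | B (x ord0 i)]) by [].
rewrite (_ : _ @^-1` _ = (fun z => coords z i) @^-1` B).
  by rewrite -[X in measurable X]setTI; exact: measurable_coords.
by apply/seteqP; split => z /=; rewrite mxE.
Qed.

Lemma measurable_fun_Rn d (T : measurableType d) (f : T -> Rn) :
  (forall i, measurable_fun setT (fun t => f t ord0 i)) ->
  measurable_fun setT f.
Proof.
move=> mf.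
have mu : measurable_fun setT (unvec \o f).
  by apply: measurable_uncoords => i _; exact: mf.
rewrite (_ : f = @vec R n.+1 \o (unvec \o f)); last first.
  by apply/funext => t /=; rewrite unvecK.
exact: (measurableT_comp measurable_vec mu).
Qed.

Lemma leb_sigma_finite : sigma_finite setT leb.
Proof.
have [F FT Foo] := lebm_sigma_finite R n.
exists (fun k => unvec @^-1` F k).
  by rewrite -preimage_bigcup -FT preimage_setT.
move=> k; have [mF Fk] := Foo k.
have e : @vec R n.+1 @^-1` (unvec @^-1` F k) = F k.
  by apply/seteqP; split=> z /=; rewrite vecK.
split; first by rewrite /measurable /= /Rn_measurable e.
by rewrite /Defs.leb /pushforward e.
Qed.

HB.instance Definition _ :=
  Measure_isSigmaFinite.Build _ _ _ leb leb_sigma_finite.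

Lemma measurable_scale s : measurable_fun setT (fun x => s *: x : Rn).
Proof.
apply: measurable_fun_Rn => i; under eq_fun do rewrite mxE.
by apply: measurable_funM => //; exact: measurable_coord.
Qed.

Lemma measurable_scale2 d (T : measurableType d) (g : T -> R) (f : T -> Rn) :
  measurable_fun setT g -> measurable_fun setT f ->
  measurable_fun setT (fun t => g t *: f t : Rn).
Proof.
move=> mg mf; apply: measurable_fun_Rn => i; under eq_fun do rewrite mxE.
by apply: measurable_funM => //; exact: (measurableT_comp (measurable_coord i)).
Qed.

Lemma measurable_sub2 d (T : measurableType d) (f g : T -> Rn) :
  measurable_fun setT f -> measurable_fun setT g ->
  measurable_fun setT (fun t => f t - g t : Rn).
Proof.
move=> mf mg; apply: measurable_fun_Rn => i; under eq_fun do rewrite !mxE.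
by apply: measurable_funB; exact: (measurableT_comp (measurable_coord i)).
Qed.

Lemma leb_scale (s : R) (A : set Rn) : 0 < s -> measurable A ->
  ((s ^+ n.+1)%:E * leb ((fun x => s *: x : Rn) @^-1` A) = leb A)%E.
Proof.
move=> s0 mA; rewrite -[RHS](lebm_dil s0 mA).
congr (_ * lebm n _)%E; apply/seteqP; split => z /=;
  rewrite (_ : @vec R n.+1 (dil n s z) = s *: @vec R n.+1 z)//;
  by apply/rowP => i; rewrite !mxE coords_uncoords -1?ltnS ?ltn_ord.
Qed.

Lemma enorm0 : enorm (0 : Rn) = 0.
Proof. by rewrite /enorm big1 ?sqrtr0// => i _; rewrite mxE expr0n. Qed.

Lemma enorm_ge0 x : 0 <= enorm x. Proof. exact: sqrtr_ge0. Qed.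

Lemma enorm_eq0 x : (enorm x == 0) = (x == 0).
Proof.
apply/idP/eqP => [|->]; last by rewrite enorm0.
rewrite sqrtr_eq0 => h.
have s0 : \sum_(i < n.+1) (x ord0 i) ^+ 2 = 0.
  by apply/le_anti; rewrite h sumr_ge0// => i _; exact: sqr_ge0.
apply/rowP => i; rewrite mxE; apply/eqP; rewrite -sqrf_eq0; apply/eqP.
by move/psumr_eq0P : s0; apply => // j _; exact: sqr_ge0.
Qed.

Lemma enorm_gt0 x : (0 < enorm x) = (x != 0).
Proof. by rewrite lt_neqAle enorm_ge0 andbT eq_sym enorm_eq0. Qed.

Lemma enormZ s x : enorm (s *: x : Rn) = `|s| * enorm x.
Proof.
rewrite /enorm; under eq_bigr do rewrite mxE exprMn.
by rewrite -mulr_sumr sqrtrM ?sqr_ge0// sqrtr_sqr.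
Qed.

Lemma enormN x : enorm (- x : Rn) = enorm x.
Proof. by rewrite -scaleN1r enormZ normrN1 mul1r. Qed.

Lemma enormB x y : enorm (x - y : Rn) = enorm (y - x : Rn).
Proof. by rewrite -enormN opprB. Qed.

Lemma enorm_sqr x : enorm x ^+ 2 = \sum_(i < n.+1) x ord0 i ^+ 2.
Proof. by rewrite sqr_sqrtr// sumr_ge0// => i _; exact: sqr_ge0. Qed.

Lemma enormD x y : enorm (x + y : Rn) <= enorm x + enorm y.
Proof.
have [->|x0] := eqVneq x 0; first by rewrite enorm0 !add0r.
have [->|y0] := eqVneq y 0; first by rewrite enorm0 !addr0.
have a0 : 0 < enorm x by rewrite enorm_gt0.
have b0 : 0 < enorm y by rewrite enorm_gt0.
set a := enorm x in a0 *; set b := enorm y in b0 *.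
rewrite -(@ler_pXn2r _ 2)// ?nnegrE ?addr_ge0 ?enorm_ge0//.
rewrite enorm_sqr.
(* pointwise AM-GM: (x_i + y_i)^2 <= (1 + b/a) x_i^2 + (1 + a/b) y_i^2 *)
apply: (@le_trans _ _ (\sum_(i < n.+1) ((1 + b / a) * x ord0 i ^+ 2
                                     + (1 + a / b) * y ord0 i ^+ 2))).
  apply: ler_sum => i _; rewrite mxE; set u := x ord0 i; set v := y ord0 i.
  have : 0 <= (b * u - a * v) ^+ 2 / (a * b).
    by rewrite divr_ge0 ?sqr_ge0// mulr_ge0// ltW.
  have -> : (b * u - a * v) ^+ 2 / (a * b) =
      b / a * u ^+ 2 + a / b * v ^+ 2 - 2 * u * v by field; rewrite !gt_eqF.
  by nra.
(* With these weights the sum is exactly (a + b)^2, so Cauchy-Schwarz is not called upon. *)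
rewrite big_split /= -!mulr_sumr -!enorm_sqr -/a -/b.
by rewrite le_eqVlt; apply/orP; left; apply/eqP; field; rewrite !gt_eqF.
Qed.

Lemma enorm_subr x y : enorm x - enorm y <= enorm (x - y : Rn).
Proof. by rewrite lerBlDr (le_trans _ (enormD _ _))// subrK. Qed.

Lemma measurable_enorm : measurable_fun setT (fun x => enorm x : R).
Proof.
apply: (@measurableT_comp _ _ _ _ _ _ (@Num.sqrt R)).
  by apply: continuous_measurable_fun; exact: sqrt_continuous.
apply: measurable_sum => i; apply: measurable_funX; exact: measurable_coord.
Qed.

Lemma normalizeZ s x : 0 < s -> normalize (s *: x) = normalize x.
Proof.
move=> s0; rewrite /normalize enormZ gtr0_norm// scalerA invfM mulrAC.
by rewrite mulVf ?gt_eqF// mul1r.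
Qed.

Lemma enorm_normalize x : x != 0 -> enorm (normalize x) = 1.
Proof.
move=> x0; rewrite /normalize enormZ ger0_norm ?invr_ge0 ?enorm_ge0//.
by rewrite mulVf// enorm_eq0.
Qed.

Lemma normalizeK x : enorm x *: normalize x = x.
Proof.
have [->|x0] := eqVneq x 0; first by rewrite /normalize !scaler0.
by rewrite /normalize scalerA mulfV ?enorm_eq0// scale1r.
Qed.

Lemma measurable_normalize : measurable_fun setT (@normalize R n.+1).
Proof.
apply: measurable_scale2; last exact: measurable_id.
under eq_fun do rewrite -powR_inv1 ?enorm_ge0//.
exact: (measurableT_comp (measurable_powR _) measurable_enorm).
Qed.

End Rn_theory.

(** * Polar-type estimates *)

Section scaled_integrals.
Context (R : realType).
Local Notation lam := (@lebesgue_measure R).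

(** Power functions are measurable, but [powR] with exponent -1 agrees with the inverse only on
    nonnegative reals; hence the form f (f^2)^-1, which also gives the conventional value 0 where f
    vanishes. *)
Lemma measurable_fun_invr d (T : measurableType d) (f : T -> R) :
  measurable_fun setT f -> measurable_fun setT (fun t => (f t)^-1).
Proof.
move=> mf; rewrite (_ : (fun _ => _) = (fun t => f t * (f t ^+ 2) `^ (-1))).
  apply: measurable_funM => //.
  by apply: (measurableT_comp (measurable_powR _)); exact: measurable_funX.
apply/funext => t; rewrite powR_inv1 ?sqr_ge0//.
have [->|f0] := eqVneq (f t) 0; first by rewrite invr0 mul0r.
by field.
Qed.

Section measure_scaling.
Context d (T : measurableType d) (m : {measure set T -> \bar R}).
Variables (phi : T -> T) (c : R).
Hypotheses (c0 : 0 < c) (mphi : measurable_fun setT phi).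
Hypothesis mE : forall A, measurable A -> (c%:E * m (phi @^-1` A) = m A)%E.

(** The hypothesis [mE] says that m is c times its image under phi, so this is a change of
    variables. It is applied to multiplication on the line and to dilations of R^n. *)
Lemma ge0_integral_scaled (f : T -> \bar R) : measurable_fun setT f ->
  (forall x, 0 <= f x)%E ->
  (\int[m]_x f (phi x) = (c^-1)%:E * \int[m]_x f x)%E.
Proof.
move=> mf f0.
pose c' : {nonneg R} := NngNum (ltW c0).
have -> : (\int[m]_x f x = c%:E * \int[m]_x f (phi x))%E.
  transitivity (\int[mscale c' (image_measure m mphi)]_x f x)%E.
    by apply: eq_measure_integral => A mA _; exact/esym/mE.
  rewrite ge0_integral_mscale//; congr (_ * _)%E.
  by rewrite (ge0_integral_pushforward mphi).
by rewrite muleA -EFinM mulVf ?gt_eqF// mul1e.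
Qed.

End measure_scaling.

Lemma ge0_integral_scale1 (c : R) (f : R -> \bar R) : 0 < c ->
  measurable_fun setT f -> (forall x, 0 <= f x)%E ->
  (\int[lam]_x f (c * x)%R = (c^-1)%:E * \int[lam]_x f x)%E.
Proof.
move=> c0 mf f0; apply: (@ge0_integral_scaled _ _ lam ( *%R c)) => //.
by move=> A mA; exact: lebesgue_measure_scale.
Qed.

Lemma integral_itv_le (f : R -> \bar R) (a b c : R) : a <= b -> 0 <= c ->
  measurable_fun setT f -> (forall s, 0 <= f s)%E ->
  (forall s, a < s < b -> (f s <= c%:E)%E) ->
  (forall s, ~~ (a < s < b) -> f s = 0%E) ->
  (\int[lam]_s f s <= (c * (b - a))%:E)%E.
Proof.
move=> ab c0 mf f0 fc fz.
have -> : (\int[lam]_s f s = \int[lam]_(s in `]a, b[) f s)%E.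
  rewrite [RHS]integral_mkcond; apply: eq_integral => s _; rewrite patchE.
  by case: ifPn => //; rewrite notin_setE /= in_itv /= => /negP/fz.
apply: (@le_trans _ _ (\int[lam]_(s in `]a, b[) cst c%:E s)%E).
  apply: ge0_le_integral => //; first exact: (measurable_funTS mf).
rewrite integral_cst//= lebesgue_measure_itv /= lte_fin.
case: ltP => _; last by rewrite mule0 lee_fin mulr_ge0// subr_ge0.
by rewrite EFinM.
Qed.

Lemma integral_itv_ge (f : R -> \bar R) (a b c : R) : a <= b -> 0 <= c ->
  measurable_fun setT f -> (forall s, 0 <= f s)%E ->
  (forall s, a < s < b -> (c%:E <= f s)%E) ->
  ((c * (b - a))%:E <= \int[lam]_s f s)%E.
Proof.
move=> ab c0 mf f0 fc.
apply: (@le_trans _ _ (\int[lam]_(s in `]a, b[) f s)%E); last first.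
  exact: ge0_subset_integral.
apply: (@le_trans _ _ (\int[lam]_(s in `]a, b[) cst c%:E s)%E); last first.
  by apply: ge0_le_integral => //; exact: measurable_funTS.
rewrite integral_cst//= lebesgue_measure_itv /= lte_fin EFinM.
case: ltP => // ba; have -> : b = a by apply/le_anti; rewrite ab ba.
by rewrite subrr !mule0.
Qed.

End scaled_integrals.

Section polar_estimates.
Context (R : realType) (n : nat).
Notation Rn := (Rn R n.+1).
Notation leb := (@leb R n.+1).
Local Notation lam := (@lebesgue_measure R).
Implicit Types x y z w : Rn.

Lemma ge0_integral_scale (s : R) (f : Rn -> \bar R) : 0 < s ->
  measurable_fun setT f -> (forall x, 0 <= f x)%E ->
  (\int[leb]_x f (s *: x)%R = (s ^- n.+1)%:E * \int[leb]_x f x)%E.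
Proof.
move=> s0 mf f0; rewrite (@ge0_integral_scaled _ _ _ leb ( *:%R s) (s ^+ n.+1)) => //.
- exact: exprn_gt0.
- exact: measurable_scale.
- by move=> A mA; exact: leb_scale.
Qed.

(** The substitute for polar coordinates: exchange the integrals, put z = w / s at fixed s, and
    exchange back. The substitution needs s > 0, hence the vanishing of F for s <= 0; the absolute
    value keeps the Jacobian nonnegative on the whole line. *)
Lemma integral_prod_scale (F : Rn * R -> \bar R) :
  measurable_fun setT F -> (forall p, 0 <= F p)%E ->
  (forall z s, s <= 0 -> F (z, s) = 0%E) ->
  (\int[leb]_z \int[lam]_s F (z, s) =
   \int[leb]_w \int[lam]_s ((`|s| ^- n.+1)%:E * F (s^-1 *: w, s)%R))%E.
Proof.
move=> mF F0 Fneg.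
rewrite (@fubini_tonelli _ _ _ _ R leb lam F)//.
have mG : measurable_fun setT (fun p : Rn * R =>
    (`|p.2| ^- n.+1)%:E * F (p.2^-1 *: p.1, p.2)%R)%E.
  apply: emeasurable_funM.
    apply/measurable_EFinP/measurable_fun_invr/measurable_funX.
    by apply: measurableT_comp => //; exact: measurable_snd.
  apply: (measurableT_comp mF); apply: measurable_fun_pair => //.
  apply: measurable_scale2 => //.
  by apply: measurable_fun_invr; exact: measurable_snd.
rewrite (@fubini_tonelli _ _ _ _ R leb lam (fun p : Rn * R =>
    (`|p.2| ^- n.+1)%:E * F (p.2^-1 *: p.1, p.2)%R)%E)//; last first.
  by move=> p; rewrite mule_ge0// lee_fin invr_ge0 exprn_ge0.
apply: eq_integral => s _ /=.
have [s0|s0] := leP s 0.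
  rewrite !integral0_eq// => x _; first by rewrite Fneg ?mule0.
  by rewrite Fneg.
have mFs : measurable_fun setT (fun w => F (s^-1 *: w, s)).
  apply: (measurableT_comp mF); apply: measurable_fun_pair => //.
  exact: measurable_scale.
rewrite gtr0_norm// ge0_integralZl//; last by rewrite lee_fin invr_ge0 exprn_ge0// ltW.
rewrite -ge0_integral_scale//; apply: eq_integral => x _.
by rewrite scalerA mulVf ?gt_eqF// scale1r.
Qed.

End polar_estimates.

(** * Volume of |x| < tau x for tau homogeneous of degree zero *)

Section cone_estimates.
Context (R : realType) (n : nat).
Notation Rn := (Rn R n.+1).
Notation leb := (@leb R n.+1).
Local Notation lam := (@lebesgue_measure R).
Implicit Types x y z w : Rn.

Definition pball : set Rn := eball (0%R : Rn) 1%R `\ (0%R : Rn).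

Lemma pballE z : pball z <-> 0 < enorm z < 1.
Proof.
rewrite /pball /eball /= subr0 enorm_gt0; split.
  by case=> -> /eqP ->.
by case/andP => /eqP ? ->.
Qed.

Lemma measurable_pred (P : Rn -> bool) : measurable_fun setT P ->
  measurable [set x | P x].
Proof.
move=> mP; rewrite [X in measurable X](_ : _ = setT `&` P @^-1` [set true]).
  exact: mP.
by rewrite setTI; apply/seteqP; split.
Qed.

Lemma measurable_pball : measurable pball.
Proof.
rewrite (_ : pball = [set z | (0 < enorm z) && (enorm z < 1)]); last first.
  by apply/seteqP; split => z /pballE.
apply: measurable_pred; apply: measurable_and; apply: measurable_fun_ltr => //;
  exact: measurable_enorm.
Qed.

Definition shell (a b : R) : set Rn := [set w | a <= enorm w < b].

Lemma measurable_shell (a b : R) : measurable (shell a b).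
Proof.
rewrite /shell; apply: measurable_pred; apply: measurable_and.
  by apply: measurable_fun_ler => //; exact: measurable_enorm.
by apply: measurable_fun_ltr => //; exact: measurable_enorm.
Qed.

Lemma outside_eballE (rho : R) :
  ~` eball (0 : Rn) rho = [set w | rho <= enorm w].
Proof.
by apply/seteqP; split => w; rewrite /eball /setC /= subr0 leNgt => /negP.
Qed.

Lemma measurable_outside (rho : R) : measurable (~` eball (0 : Rn) rho).
Proof.
rewrite outside_eballE; apply: measurable_pred.
by apply: measurable_fun_ler => //; exact: measurable_enorm.
Qed.

(* Both estimates of this section compare with
   D = \int_{0 < |z| < 1} \int_{tau z < s < 2 tau z} s^n ds dz (here R^n is Rn n.+1):
   integrating in s first gives \int tau^(n+1), while the substitution z = w / s
   turns D into an integral over |w| < s of 1 / s. *)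
Section layer_cake.
Variable tau : Rn -> R.
Hypotheses (mtau : measurable_fun setT tau) (tau0 : forall x, 0 <= tau x).
Hypothesis tauZ : forall s x, 0 < s -> x != 0 -> tau (s *: x) = tau x.

Let E := [set x | 0 < enorm x < tau x].

Let F (p : Rn * R) : \bar R :=
  if [&& 0 < enorm p.1, enorm p.1 < 1, tau p.1 < p.2 & p.2 < tau p.1 + tau p.1]
  then (`|p.2| ^+ n)%:E else 0%E.

Let F_ge0 p : (0 <= F p)%E.
Proof. by rewrite /F; case: ifP => // _; rewrite lee_fin exprn_ge0. Qed.

Let mF : measurable_fun setT F.
Proof.
have m1 : measurable_fun setT (fun p : Rn * R => enorm p.1).
  by apply: (measurableT_comp (@measurable_enorm _ _)); exact: measurable_fst.
have mt : measurable_fun setT (fun p : Rn * R => tau p.1).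
  by apply: (measurableT_comp mtau); exact: measurable_fst.
apply: measurable_fun_ifT => //.
  do !apply: measurable_and; apply: measurable_fun_ltr => //; try exact: measurable_snd.
  exact: measurable_funD.
by apply/measurable_EFinP/measurable_funX/measurableT_comp.
Qed.

Let F_neg z s : s <= 0 -> F (z, s) = 0%E.
Proof.
rewrite /F /= => s0; case: ifP => // /and4P[_ _ ts _].
by have := lt_le_trans ts s0; rewrite ltNge tau0.
Qed.

Let G w s := ((`|s| ^- n.+1)%:E * F (s^-1 *: w, s)%R)%E.

Let G_ge0 w s : (0 <= G w s)%E.
Proof. by rewrite /G mule_ge0// lee_fin invr_ge0 exprn_ge0. Qed.

Let mG w : measurable_fun setT (G w).
Proof.
apply: emeasurable_funM.
  apply/measurable_EFinP/measurable_fun_invr; apply: measurable_funX.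
  exact: normr_measurable.
apply: (@measurableT_comp _ _ _ _ _ _ F _ (fun s : R => (s^-1 *: w, s)) mF).
apply: measurable_fun_pair => //.
by apply: measurable_scale2 => //; exact: measurable_fun_invr.
Qed.

Let GE w s : G w s = if [&& 0 < s, 0 < enorm w, enorm w < s, tau w < s &
   s < tau w + tau w] then (s^-1)%:E else 0%E.
Proof.
rewrite /G; have [s0|s0] := leP s 0; first by rewrite F_neg// mule0.
rewrite /F /= enormZ normfV gtr0_norm//.
rewrite pmulr_rgt0 ?invr_gt0// ltr_pdivrMl// mulr1.
case w0 : (0 < enorm w) => /=; last by rewrite mule0.
rewrite tauZ ?invr_gt0// -?enorm_gt0//.
case: ifP => _; last by rewrite mule0.
rewrite -EFinM exprS invfM -mulrA mulVf ?mulr1// gt_eqF//.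
exact: exprn_gt0.
Qed.

Let D := (\int[leb]_z \int[lam]_s F (z, s))%E.

Let DE : (D = \int[leb]_w \int[lam]_s G w s)%E.
Proof. exact: integral_prod_scale. Qed.

Let mFz z : measurable_fun setT (fun s => F (z, s)).
Proof.
apply: (@measurableT_comp _ _ _ _ _ _ F _ (fun s : R => (z, s)) mF).
exact: measurable_fun_pair.
Qed.

Let mF1 : measurable_fun setT (fun z => \int[lam]_s F (z, s))%E.
Proof. exact: (@measurable_fun_fubini_tonelli_F _ _ _ _ R lam F). Qed.

Let mG1 : measurable_fun setT (fun w => \int[lam]_s G w s)%E.
Proof.
apply: (@measurable_fun_fubini_tonelli_F _ _ _ _ R lam (fun p => G p.1 p.2)) => //.
apply: emeasurable_funM.
  by apply/measurable_EFinP/measurable_fun_invr/measurable_funX/measurableT_comp.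
apply: (@measurableT_comp _ _ _ _ _ _ F _
  (fun p : Rn * R => (p.2^-1 *: p.1, p.2)) mF).
apply: measurable_fun_pair => //.
apply: measurable_scale2 => //.
by apply: measurable_fun_invr; exact: measurable_snd.
Qed.

Let mE : measurable E.
Proof.
apply: measurable_pred; apply: measurable_and; apply: measurable_fun_ltr => //;
  exact: measurable_enorm.
Qed.

Let mtaun : measurable_fun setT (fun z => (tau z ^+ n.+1)%:E).
Proof. by apply/measurable_EFinP/measurable_funX. Qed.

Let taun0 z : (0 <= (tau z ^+ n.+1)%:E)%E.
Proof. by rewrite lee_fin exprn_ge0. Qed.

Lemma integral_pball_le_cone :
  (\int[leb]_(z in pball) (tau z ^+ n.+1)%:E <= (2 ^+ n.+1)%:E * leb E)%E.
Proof.
pose E2 := [set w | 0 < enorm w < 2 * tau w].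
have mE2 : measurable E2.
  apply: measurable_pred; apply: measurable_and; apply: measurable_fun_ltr => //;
    try exact: measurable_enorm.
  exact: measurable_funM.
(* The inner integral lives on |w| < s < 2 tau w, which only forces w into [E2]; by homogeneity of
   tau this is the dilate of E by 2. *)
have -> : ((2 ^+ n.+1)%:E * leb E = leb E2)%E.
  rewrite -(@leb_scale _ _ 2 _ _ mE2)//; congr (_ * leb _)%E.
  have key x : (0 < enorm (2 *: x) < 2 * tau (2 *: x)) = (0 < enorm x < tau x).
    rewrite enormZ (gtr0_norm (ltr0n R 2)) (pmulr_rgt0 _ (ltr0n R 2)).
    case x0 : (0 < enorm x) => //=; rewrite tauZ; [|exact: ltr0n|by rewrite -enorm_gt0].
    by rewrite ltr_pM2l.
  by apply/seteqP; split=> x; rewrite /E /E2 /preimage /mkset key.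
apply: (@le_trans _ _ D).
  rewrite integral_mkcond; apply: ge0_le_integral => //.
  - by move=> z _; rewrite patchE; case: ifP.
  - by apply/(measurable_restrictT _ measurable_pball)/measurable_funTS.
  move=> z _; rewrite patchE; case: ifPn => [|_]; last exact: integral_ge0.
  rewrite inE => /pballE /andP[z0 z1].
  rewrite exprSr [X in _ * X](_ : _ = (tau z + tau z) - tau z); last by rewrite addrK.
  apply: integral_itv_ge => //.
  - by rewrite lerDl.
  - by rewrite exprn_ge0.
  - move=> s /andP[s1 s2]; rewrite /F /= z0 z1 s1 s2 /= lee_fin lerXn2r ?nnegrE//.
    by rewrite (le_trans (ltW s1))// ler_norm.
rewrite DE -[leb E2]mul1e -integral_cst// [leRHS]integral_mkcond.
apply: ge0_le_integral => //.
- by move=> w _; exact: integral_ge0.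
- exact/(measurable_restrictT _ mE2).
move=> w _; rewrite patchE; case: ifPn.
  rewrite inE => /= /andP[w0 w1].
  have t0 : 0 < tau w by rewrite -(@pmulr_rgt0 _ 2)//; exact: lt_trans w1.
  (* The integral of 1 / s over (tau, 2 tau) is log 2; the crude bounds 1 here and 1/2 in the
     reverse estimate suffice. *)
  apply: (@le_trans _ _ ((tau w)^-1 * ((tau w + tau w) - tau w))%:E).
    apply: integral_itv_le => //.
    + by rewrite lerDl.
    + by rewrite invr_ge0.
    + move=> s /andP[s1 s2]; rewrite GE; case: ifP => _; last by rewrite lee_fin invr_ge0.
      by have s0 := lt_trans t0 s1; rewrite lee_fin lef_pV2 ?posrE// ltW.
    + move=> s /negP h; rewrite GE; case: ifP => // /and5P[_ _ _ h1 h2].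
      by exfalso; apply: h; rewrite h1.
  by rewrite addrK mulVf ?gt_eqF.
rewrite notin_setE /= => h; rewrite integral0_eq// => s _.
rewrite GE; case: ifP => // /and5P[_ w0 ws h1 h2].
by exfalso; apply: h; apply/andP; split=> //; move: ws h2; lra.
Qed.

Lemma cone_le_integral_pball :
  (leb E <= (2 ^+ n.+1)%:E * \int[leb]_(z in pball) (tau z ^+ n.+1)%:E)%E.
Proof.
(* When |w| < tau w, every s in (tau w, 2 tau w) exceeds |w|, so the whole interval contributes. *)
have h1 : ((2^-1)%:E * leb E <= D)%E.
  rewrite DE -integral_cst// [leLHS]integral_mkcond.
  apply: ge0_le_integral => //.
  - by move=> w _; rewrite patchE; case: ifP => // _; rewrite lee_fin.
  - exact/(measurable_restrictT _ mE).
  move=> w _; rewrite patchE; case: ifPn => [|_]; last exact: integral_ge0.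
  rewrite inE => /= /andP[w0 w1].
  have t0 : 0 < tau w by exact: lt_trans w1.
  apply: (@le_trans _ _ ((tau w + tau w)^-1 * ((tau w + tau w) - tau w))%:E).
    rewrite addrK (_ : (tau w + tau w)^-1 * tau w = 2^-1)//.
    by field; rewrite gt_eqF ?addr_gt0.
  apply: integral_itv_ge => //.
  - by rewrite lerDl.
  - by rewrite invr_ge0 addr_ge0.
  - move=> s /andP[s1 s2]; have s0 := lt_trans t0 s1.
    rewrite GE s0 w0 (lt_trans w1)// s1 s2 /= lee_fin lef_pV2 ?posrE ?addr_gt0//.
    exact: ltW.
have h2 : (D <= (2 ^+ n)%:E * \int[leb]_(z in pball) (tau z ^+ n.+1)%:E)%E.
  rewrite integral_mkcond -ge0_integralZl//; last 2 first.
  - exact/(measurable_restrictT _ measurable_pball)/measurable_funTS.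
  - by move=> z _; rewrite patchE; case: ifP.
  apply: ge0_le_integral => //.
  - by move=> z _; exact: integral_ge0.
  - apply: measurable_funeM.
    exact/(measurable_restrictT _ measurable_pball)/measurable_funTS.
  move=> z _; rewrite patchE; case: ifPn.
    rewrite inE => /pballE /andP[z0 z1].
    apply: (@le_trans _ _ ((tau z + tau z) ^+ n * ((tau z + tau z) - tau z))%:E).
      apply: integral_itv_le => //.
      + by rewrite lerDl.
      + by rewrite exprn_ge0// addr_ge0.
      + move=> s /andP[s1 s2]; rewrite /F /= z0 z1 s1 s2 /= lee_fin.
        by rewrite lerXn2r ?nnegrE ?addr_ge0// ger0_norm ?ltW// (le_lt_trans _ s1).
      + move=> s /negP h; rewrite /F; case: ifP => // /and4P[_ _ /= h1' h2'].
        by exfalso; apply: h; rewrite h1'.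
    rewrite addrK (_ : tau z + tau z = 2 * tau z); last by rewrite mulr2n mulrDl mul1r.
    by rewrite exprMn -mulrA -exprSr -EFinM.
  rewrite notin_setE => /= h; rewrite integral0_eq ?mule0// => s _.
  rewrite /F; case: ifP => // /and4P[/= h1' h2' _ _].
  by exfalso; apply: h; apply/pballE; rewrite h1'.
rewrite exprS EFinM -muleA -[leLHS]mul1e.
rewrite (_ : 1%E = (2%:E * (2^-1)%:E)%E); last by rewrite -EFinM divff.
by rewrite -muleA lee_pmul2l// (le_trans h1).
Qed.

End layer_cake.
End cone_estimates.

(** * Shell integrals bounded by integrals over spheres *)

Section shell_estimate.
Context (R : realType) (n : nat).
Notation Rn := (Rn R n.+1).
Notation leb := (@leb R n.+1).
Local Notation lam := (@lebesgue_measure R).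
Implicit Types x y z w : Rn.
Variable K : Rn -> R.
Hypotheses (mK : measurable_fun setT K) (K0 : forall x, 0 <= K x).

(** For 1 <= |w| < 2 the window 1 < s < 4 contains every s with 1/2 < |w| / s < 1. The radius r = s
    |z| then ranges within (1/2, 4), the window of [H]. *)
Let F (p : Rn * R) : \bar R :=
  if [&& 2^-1 < enorm p.1, enorm p.1 < 1, 1 < p.2 & p.2 < 4]
  then (K (p.2 *: p.1))%:E else 0%E.

Let H (p : Rn * R) : \bar R :=
  if [&& 0 < enorm p.1, enorm p.1 < 1, 2^-1 < p.2 & p.2 < 4]
  then (K (p.2 *: normalize p.1))%:E else 0%E.

Let F_ge0 p : (0 <= F p)%E.
Proof. by rewrite /F; case: ifP => // _; rewrite lee_fin. Qed.

Let H_ge0 p : (0 <= H p)%E.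
Proof. by rewrite /H; case: ifP => // _; rewrite lee_fin. Qed.

Let m1 : measurable_fun setT (fun p : Rn * R => enorm p.1).
Proof. by apply: (measurableT_comp (@measurable_enorm _ _)); exact: measurable_fst. Qed.

Let mF : measurable_fun setT F.
Proof.
apply: measurable_fun_ifT => //.
  by do !apply: measurable_and; apply: measurable_fun_ltr => //; exact: measurable_snd.
by apply/measurable_EFinP/(measurableT_comp mK)/measurable_scale2.
Qed.

Let mH : measurable_fun setT H.
Proof.
apply: measurable_fun_ifT => //.
  by do !apply: measurable_and; apply: measurable_fun_ltr => //; exact: measurable_snd.
apply/measurable_EFinP/(measurableT_comp mK)/measurable_scale2 => //.
by apply: (measurableT_comp (@measurable_normalize _ _)); exact: measurable_fst.
Qed.

Let mHz z : measurable_fun setT (fun s => H (z, s)).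
Proof.
apply: (@measurableT_comp _ _ _ _ _ _ H _ (fun s : R => (z, s)) mH).
exact: measurable_fun_pair.
Qed.

Let mH1 : measurable_fun setT (fun z => \int[lam]_s H (z, s))%E.
Proof. exact: (@measurable_fun_fubini_tonelli_F _ _ _ _ R lam H). Qed.

Let mH2 : measurable_fun setT (fun s => \int[leb]_z H (z, s))%E.
Proof. exact: (@measurable_fun_fubini_tonelli_G _ _ _ _ R leb H). Qed.

Let mFz z : measurable_fun setT (fun s => F (z, s)).
Proof.
apply: (@measurableT_comp _ _ _ _ _ _ F _ (fun s : R => (z, s)) mF).
exact: measurable_fun_pair.
Qed.

Let mF1 : measurable_fun setT (fun z => \int[lam]_s F (z, s))%E.
Proof. exact: (@measurable_fun_fubini_tonelli_F _ _ _ _ R lam F). Qed.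

(** Substitution r = |z| s at fixed z; the factor 2 bounds the Jacobian 1 / |z|. *)
Let FH z : (\int[lam]_s F (z, s) <= 2%:E * \int[lam]_s H (z, s))%E.
Proof.
have [/andP[z2 z1]|h] := boolP (2^-1 < enorm z < 1); last first.
  rewrite integral0_eq ?mule_ge0 ?integral_ge0// => s _.
  by rewrite /F /=; case: ifP => // /and4P[a b _ _]; rewrite a b in h.
have z0 : 0 < enorm z by rewrite (lt_trans _ z2)// invr_gt0.
apply: (@le_trans _ _ (\int[lam]_s H (z, (enorm z * s)%R))%E).
  apply: ge0_le_integral => //.
  - exact: mFz.
  - have mc : measurable_fun setT (fun s : R => enorm z * s) by exact: mulrl_measurable.
    exact: (measurableT_comp (mHz z) mc).
  move=> s _; rewrite /F /= z2 z1 /=; case: ifP => // /andP[s1 s4].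
  rewrite /H /= z0 z1 /= ifT; last by apply/andP; split; nra.
  by rewrite [enorm z * s]mulrC -scalerA normalizeK.
rewrite (ge0_integral_scale1 z0 (mHz z))//.
apply: lee_wpmul2r; first exact: integral_ge0.
by rewrite lee_fin -[leRHS]invrK lef_pV2 ?posrE ?invr_gt0// ltW.
Qed.

Let G w s := ((`|s| ^- n.+1)%:E * F (s^-1 *: w, s)%R)%E.

Let G_ge0 w s : (0 <= G w s)%E.
Proof. by rewrite /G mule_ge0// lee_fin invr_ge0 exprn_ge0. Qed.

Let mG2 : measurable_fun setT (fun p : Rn * R => G p.1 p.2).
Proof.
apply: emeasurable_funM.
  by apply/measurable_EFinP/measurable_fun_invr/measurable_funX/measurableT_comp.
apply: (@measurableT_comp _ _ _ _ _ _ F _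
  (fun p : Rn * R => (p.2^-1 *: p.1, p.2)) mF).
apply: measurable_fun_pair => //.
apply: measurable_scale2 => //.
by apply: measurable_fun_invr; exact: measurable_snd.
Qed.

Let mG w : measurable_fun setT (G w).
Proof.
apply: (@measurableT_comp _ _ _ _ _ _ (fun p : Rn * R => G p.1 p.2) _ (fun s => (w, s)) mG2).
exact: measurable_fun_pair.
Qed.

Let mG1 : measurable_fun setT (fun w => \int[lam]_s G w s)%E.
Proof.
exact: (@measurable_fun_fubini_tonelli_F _ _ _ _ R lam (fun p => G p.1 p.2)).
Qed.


(* The double integral \int_{1/2 < |z| < 1} \int_{1 < s < 4} K (s z) ds dz is bounded
   above through r = s |z| at fixed z, and below through w = s z at fixed s. *)
Lemma shell_le_sphere (M : R) : 0 <= M ->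
  (forall r, 2^-1 < r < 4 ->
     (\int[leb]_(z in @pball R n) (K (r *: normalize z))%:E <= M%:E)%E) ->
  (\int[leb]_(w in @shell R n 1%R 2%R) (K w)%:E <= (4 ^+ n.+1 * 7 * M)%:E)%E.
Proof.
move=> M0 hM.
(* Only s in (|w|, 2 |w|) is kept: this interval has length at least 1, and there s^-(n+1) is at
   least 4^-(n+1). *)
have low : ((4 ^- n.+1)%:E * \int[leb]_(w in @shell R n 1%R 2%R) (K w)%:E
            <= \int[leb]_w \int[lam]_s G w s)%E.
  have mshell : measurable (@shell R n 1 2) by exact: measurable_shell.
  rewrite integral_mkcond -ge0_integralZl//; last 2 first.
  - by apply/(measurable_restrictT _ mshell)/measurable_EFinP/measurable_funTS.
  - by move=> z _; rewrite patchE; case: ifP => // _; rewrite lee_fin.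
  apply: ge0_le_integral => //.
  - move=> z _; rewrite mule_ge0 ?lee_fin ?invr_ge0 ?exprn_ge0// patchE.
    by case: ifP => // _; rewrite lee_fin.
  - apply: measurable_funeM.
    by apply/(measurable_restrictT _ mshell)/measurable_EFinP/measurable_funTS.
  move=> w _; rewrite patchE; case: ifPn => [|_]; last by rewrite mule0 integral_ge0.
  rewrite inE => /andP[w1 w2].
  apply: (@le_trans _ _ ((4 ^- n.+1 * K w) * ((enorm w + enorm w) - enorm w))%:E).
    by rewrite addrK -EFinM lee_fin ler_peMr// mulr_ge0// invr_ge0 exprn_ge0.
  apply: integral_itv_ge => //.
  - by rewrite lerDl enorm_ge0.
  - by rewrite mulr_ge0// invr_ge0 exprn_ge0.
  - move=> s /andP[s1 s2]; have s0 : 0 < s by apply: lt_trans s1; lra.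
    have sw : enorm (s^-1 *: w) = enorm w / s.
      by rewrite enormZ gtr0_norm ?invr_gt0// mulrC.
    rewrite /G /F /= sw ifT; last first.
      rewrite ltr_pdivlMr// ltr_pdivrMr//; apply/and4P; split; lra.
    rewrite scalerA mulfV ?gt_eqF// scale1r -EFinM lee_fin ler_wpM2r//.
    rewrite gtr0_norm// lef_pV2 ?posrE ?exprn_gt0// lerXn2r ?nnegrE ?ltW//; lra.
(* Here 7 = 2 (4 - 1/2): the Jacobian bound times the length of the range of r. *)
have up : (\int[leb]_w \int[lam]_s G w s <= (7 * M)%:E)%E.
  rewrite -(@integral_prod_scale _ _ F)//; last first.
    move=> z s s0; rewrite /F; case: ifP => // /and4P[/= _ _ h _].
    by have := lt_le_trans h s0; rewrite ltr10.
  apply: (@le_trans _ _ (2%:E * \int[leb]_z \int[lam]_s H (z, s))%E).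
    rewrite -ge0_integralZl//; last by move=> z _; exact: integral_ge0.
    apply: ge0_le_integral => //; last exact: measurable_funeM.
    by move=> z _; exact: integral_ge0.
  rewrite (@fubini_tonelli _ _ _ _ R leb lam H)//.
  rewrite (_ : 7 * M = 2 * (M * (4 - 2^-1))); last by field.
  rewrite EFinM lee_pmul2l//; apply: integral_itv_le => //.
  - by lra.
  - by move=> s; exact: integral_ge0.
  - move=> s s12; apply: le_trans (hM _ s12).
    rewrite [leRHS]integral_mkcond le_eqVlt; apply/orP; left; apply/eqP.
    apply: eq_integral => z _; rewrite patchE /H /= s12 andbT.
    case: ifP => [h|/negP h]; first by rewrite mem_set//; apply/pballE.
    by rewrite memNset// => /pballE.
  - move=> s /negP h; rewrite integral0_eq// => z _.
    by rewrite /H; case: ifP => // /and4P[_ _ /= h1 h2]; exfalso; apply: h; rewrite h1.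
have c0 : 0 < (4 : R) ^+ n.+1 by rewrite exprn_gt0.
rewrite -mulrA EFinM; rewrite [leLHS](_ : _ =
    (4 ^+ n.+1)%:E * ((4 ^- n.+1)%:E * \int[leb]_(w in @shell R n 1%R 2%R) (K w)%:E))%E.
  by rewrite lee_pmul2l//; exact: le_trans up.
by rewrite muleA -EFinM mulfV ?mul1e// lt0r_neq0.
Qed.

End shell_estimate.

(** * The Dini condition *)

Section dini.
Context (R : realType) (n : nat).
Notation Rn := (Rn R n.+1).
Notation leb := (@leb R n.+1).
Local Notation lam := (@lebesgue_measure R).
Implicit Types x y z w : Rn.

(** Preimages of rays under a monotone function are intervals. This gives the measurability of
    [omega_q]. *)
Lemma measurable_nondecreasing (e : R -> \bar R) :
  (forall s t, s <= t -> (e s <= e t)%E) -> measurable_fun setT e.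
Proof.
move=> mono; apply: (measurability _ (ErealGenOInfty.measurableE R)) => //.
move=> _ [_ [c ->] <-]; rewrite setTI; apply: is_interval_measurable.
move=> s t /=; rewrite !in_itv /= !andbT => cs _ u /andP[su _].
by rewrite in_itv /= andbT (lt_le_trans cs)// mono.
Qed.

Section modulus.
Variables (q : R) (Om : Rn -> R).
Hypothesis q1 : 1 <= q.

(** The map x -> x / (1 + |x|) carries nonzero vectors into the punctured unit ball without changing
    their direction. The value at the origin is arbitrary and treated separately. *)
Lemma measurable_homogeneous : homogeneous0 Om ->
  measurable_fun (@pball R n) (Om \o @normalize R n.+1) ->
  measurable_fun setT Om.
Proof.
move=> hOm mg.
pose g := (Om \o @normalize R n.+1) \_ (@pball R n).
have mg' : measurable_fun setT g.
  exact/(measurable_restrictT _ (@measurable_pball R n)).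
pose h x : Rn := (1 + enorm x)^-1 *: x.
have mh : measurable_fun setT h.
  apply: measurable_scale2 => //; apply: measurable_fun_invr.
  by apply: measurable_funD => //; exact: measurable_enorm.
rewrite (_ : Om = fun x => if 0 < enorm x then g (h x) else Om 0).
  apply: measurable_fun_ifT => //; last exact: measurableT_comp mh.
  by apply: measurable_fun_ltr => //; exact: measurable_enorm.
apply/funext => x; case: ifPn => [x0|]; last first.
  by rewrite enorm_gt0 negbK => /eqP ->.
have c0 : 0 < 1 + enorm x by rewrite addr_gt0.
rewrite /g patchE mem_set; last first.
  apply/pballE; rewrite /h enormZ gtr0_norm ?invr_gt0// mulr_gt0 ?invr_gt0//=.
  by rewrite ltr_pdivrMl// mulr1 ltrDr.
rewrite /= /h normalizeZ ?invr_gt0// /normalize hOm ?invr_gt0//.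
by rewrite -enorm_gt0.
Qed.

(** For t >= 0 this is the q-th power of [omega_q], the quantity that bounds shell integrals
    directly. *)
Definition modulus (t : R) : \bar R :=
  ereal_sup [set sph_int (fun y => (`|Om (y + h) - Om y| `^ q)%:E)
            | h in [set h : Rn | enorm h <= t]].

Lemma sph_int_ge0 (g : Rn -> \bar R) : (forall x, 0 <= g x)%E ->
  (0 <= sph_int g)%E.
Proof. by move=> g0; rewrite /sph_int mule_ge0// integral_ge0. Qed.

Lemma modulus_ge0 t : 0 <= t -> (0 <= modulus t)%E.
Proof.
move=> t0.
apply: (@le_trans _ _ (sph_int (fun y => (`|Om (y + 0) - Om y| `^ q)%:E))).
  by apply: sph_int_ge0 => x; rewrite lee_fin powR_ge0.
by apply: ereal_sup_ubound; exists 0; rewrite //= enorm0.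
Qed.

Lemma modulus_le s t : s <= t -> (modulus s <= modulus t)%E.
Proof.
move=> st; apply: ereal_sup_le => _ [h /= hs <-]; exists h => //=.
exact: le_trans st.
Qed.

Lemma modulus_neg s : s < 0 -> modulus s = -oo%E.
Proof.
move=> s0; rewrite /modulus (_ : [set h : Rn | _] = set0) ?image_set0 ?ereal_sup0//.
apply/seteqP; split => // h /= hs.
by have := le_lt_trans hs s0; rewrite ltNge enorm_ge0.
Qed.

(** For negative t the supremum over the empty set is -oo and its power is 0, so monotonicity holds
    on the whole line, as the measurability argument requires. *)
Lemma omega_q_le s t : s <= t -> (omega_q q Om s <= omega_q q Om t)%E.
Proof.
move=> st; rewrite /omega_q -!/(modulus _).
have q0 : q^-1 != 0 by rewrite invr_neq0// gt_eqF// (lt_le_trans _ q1).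
have [s0|s0] := ltP s 0; first by rewrite modulus_neg// poweRNyr// poweR_ge0.
have t0 := le_trans s0 st.
apply: gt0_ler_poweR; rewrite ?in_itv /= ?leey ?andbT ?modulus_ge0//.
  by rewrite invr_ge0 (le_trans _ q1).
exact: modulus_le.
Qed.

(** On the interval from 2^-(k+1) to 2^-k, [omega_q] is at least its value at 2^-(k+1) and 1 / t is
    at least 2^k, so the Dini integral over it is at least half of the k-th term. *)
Lemma dini_sum : Lq_Dini q Om ->
  (\sum_(0 <= k <oo) omega_q q Om (2^-1 ^+ k.+1) < +oo)%E.
Proof.
case=> _ foo'.
pose f t := (omega_q q Om t * ((t `^ (1 + 0))^-1)%:E)%E.
have foo : (\int[lam]_(t in `]0%R, 1%R]) f t < +oo)%E by [].
pose D k : set R := `]2^-1 ^+ k.+1, 2^-1 ^+ k]%classic.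
have half0 k : 0 < (2^-1 : R) ^+ k by rewrite exprn_gt0// invr_gt0.
have half1 j k : (j <= k)%N -> (2^-1 : R) ^+ k <= 2^-1 ^+ j.
  by move=> jk; apply: ler_wiXn2l; rewrite ?invr_ge0// invf_le1// ler1n.
have f0 t : (0 <= f t)%E.
  by rewrite /f mule_ge0 ?poweR_ge0// lee_fin invr_ge0 powR_ge0.
have mf : measurable_fun setT f.
  apply: emeasurable_funM; first exact: measurable_nondecreasing omega_q_le.
  by apply/measurable_EFinP/measurable_fun_invr; exact: measurable_powR.
have mD k : measurable (D k : set (measurableTypeR R)) by exact: measurable_itv.
have mfT (A : set (measurableTypeR R)) : measurable_fun A f.
  exact: (measurable_funTS mf).
have tD : trivIset setT D.
  apply/trivIsetP => i j _ _; wlog ij : i j / (i < j)%N.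
    move=> H ij; move: (ij); rewrite neq_ltn => /orP[|] ij'; first exact: H.
    by rewrite setIC; apply: H => //; rewrite eq_sym.
  move=> _; apply/seteqP; split => // t []; rewrite /D /= !in_itv /=.
  move=> /andP[it _] /andP[_ tj]; have := lt_le_trans it tj.
  by rewrite ltNge half1.
have le1 : (\sum_(0 <= k <oo) \int[lam]_(t in D k) f t < +oo)%E.
  rewrite -(@ge0_integral_bigcup _ _ _ lam D f)//.
  apply: le_lt_trans foo; apply: ge0_subset_integral => //.
  - exact: bigcupT_measurable.
  - move=> t [k _]; rewrite /D /= !in_itv /= => /andP[kt tk].
    by rewrite (lt_trans _ kt)//= (le_trans tk)// -(expr0 2^-1) half1.
have le2 k : (omega_q q Om (2^-1 ^+ k.+1) <= 2%:E * \int[lam]_(t in D k) f t)%E.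
  pose c := (omega_q q Om (2^-1 ^+ k.+1) * (2 ^+ k)%:E)%E.
  apply: (@le_trans _ _ (2%:E * \int[lam]_(t in D k) cst c t)%E).
    rewrite integral_cst//= lebesgue_measure_itv /= lte_fin.
    have -> : (2^-1 : R) ^+ k.+1 < 2^-1 ^+ k.
      by rewrite exprS gtr_pMl// invf_lt1// ltr1n.
    rewrite /c -EFinB muleCA -!muleA -!EFinM.
    rewrite (_ : 2 ^+ k * (2 * _) = 1 :> R) ?mule1//.
    rewrite exprS exprVn; field.
    by rewrite expf_neq0.
  rewrite lee_pmul2l//; apply: ge0_le_integral => //.
  - by move=> t _; rewrite mule_ge0 ?poweR_ge0// lee_fin exprn_ge0.
  - move=> t; rewrite /D /= in_itv /= => /andP[kt tk]; rewrite /c /f.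
    apply: lee_pmul; rewrite ?poweR_ge0 ?lee_fin ?exprn_ge0//.
      exact/omega_q_le/ltW.
    have t0 : 0 < t by rewrite (lt_trans _ kt).
    rewrite addr0 powRr1 ?(ltW t0)//.
    by rewrite -[leLHS]invrK lef_pV2 ?posrE ?invr_gt0 ?exprn_gt0// -exprVn.
apply: le_lt_trans.
  apply: (@lee_nneseries _ _ (fun k => 2%:E * \int[lam]_(t in D k) f t)%E) => //.
  by move=> k _ _; exact: poweR_ge0.
rewrite nneseriesZl; last by move=> k _; exact: integral_ge0.
by rewrite lte_mul_pinfty.
Qed.

(* Where omega_q <= 1 its q-th power, the modulus, is dominated by omega_q. *)
Lemma modulus_le_omega (t : R) : 0 <= t -> (omega_q q Om t <= 1)%E ->
  (modulus t <= omega_q q Om t)%E.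
Proof.
move=> t0; rewrite /omega_q -!/(modulus _) => h.
have q0 : 0 < q by rewrite (lt_le_trans _ q1).
rewrite [leLHS](_ : _ = ((modulus t `^ q^-1) `^ q)%E); last first.
  by rewrite -poweRrM mulVf ?gt_eqF// poweRe1// modulus_ge0.
move: (poweR_ge0 (modulus t) q^-1) h.
case: (modulus t `^ q^-1)%E => [r|//|//]; rewrite poweR_EFin !lee_fin => r0 r1.
have [->|rn0] := eqVneq r 0; first by rewrite powR0// gt_eqF.
by rewrite ge1r_powR// r1 andbT lt_neqAle eq_sym rn0.
Qed.

End modulus.
End dini.

(** * Oscillation of Om outside a ball *)

Section oscillation.
Context (R : realType) (n : nat).
Notation Rn := (Rn R n.+1).
Notation leb := (@leb R n.+1).
Implicit Types x y z w : Rn.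
Variables (q : R) (Om : Rn -> R).
Hypotheses (q1 : 1 <= q) (hOm : homogeneous0 Om) (mOm : measurable_fun setT Om).

Definition osc y x : R := `|Om (x - y) - Om x| `^ q.

Lemma osc_ge0 y x : 0 <= osc y x. Proof. exact: powR_ge0. Qed.

Lemma measurable_osc2 : measurable_fun setT (fun p : Rn * Rn => osc p.2 p.1).
Proof.
apply: (measurableT_comp (measurable_powR _)); apply: measurableT_comp => //.
apply: measurable_funB; apply: (measurableT_comp mOm) => //.
by apply: measurable_sub2.
Qed.

Lemma measurable_osc y : measurable_fun setT (osc y).
Proof.
have mp : measurable_fun setT (fun x : Rn => (x, y)) by exact: measurable_fun_pair.
exact: (measurableT_comp measurable_osc2 mp).
Qed.

(** The condition on y keeps x - y / s away from the origin, where homogeneity says nothing. *)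
Lemma oscZ s y x : 0 < s -> enorm y < s * enorm x ->
  osc y (s *: x) = osc (s^-1 *: y) x.
Proof.
move=> s0 yx.
have x0 : x != 0.
  by apply: contraTneq yx => ->; rewrite enorm0 mulr0 ltNge enorm_ge0.
rewrite /osc hOm//; congr (`|_ - _| `^ _).
rewrite -(hOm s0 (x := x - s^-1 *: y)).
  by rewrite scalerBr scalerA mulfV ?gt_eqF// scale1r.
rewrite subr_eq0; apply: contraTneq yx => ->.
by rewrite enormZ gtr0_norm ?invr_gt0// mulrA mulfV ?gt_eqF// mul1r ltxx.
Qed.

(** On the sphere of radius r > 1/2, translation by -y becomes on the unit sphere translation by h =
    -y / r, and |h| <= 2 |y|; this is the argument of the modulus. *)
Lemma osc_shell y (M : R) : 0 <= M -> enorm y < 2^-1 ->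
  (modulus q Om (2 * enorm y) <= M%:E)%E ->
  (\int[leb]_(w in @shell R n 1%R 2%R) (osc y w)%:E
    <= (4 ^+ n.+1 * 7 * M)%:E)%E.
Proof.
move=> M0 y2 yM; apply: shell_le_sphere => //.
- exact: measurable_osc.
- by move=> x; exact: osc_ge0.
move=> r /andP[r2 r4]; have r0 : 0 < r by rewrite (lt_trans _ r2)// invr_gt0.
apply: le_trans yM; set h : Rn := - (r^-1 *: y).
have hy : enorm h <= 2 * enorm y.
  rewrite enormN enormZ gtr0_norm ?invr_gt0// ler_wpM2r ?enorm_ge0//.
  by rewrite -[leRHS]invrK lef_pV2 ?posrE ?invr_gt0// ltW.
apply: (@le_trans _ _ (sph_int (fun z => (`|Om (z + h) - Om z| `^ q)%:E))); last first.
  by apply: ereal_sup_ubound; exists h.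
have -> : (\int[leb]_(z in @pball R n) (osc y (r *: normalize z))%:E =
    \int[leb]_(z in @pball R n) (`|Om (normalize z + h) - Om (normalize z)| `^ q)%:E)%E.
  apply: eq_integral => z; rewrite inE => /pballE /andP[z0 _].
  rewrite oscZ// enorm_normalize -?enorm_gt0// mulr1.
  exact: lt_trans r2.
rewrite /sph_int; set X := (X in (X <= _)%E).
have X0 : (0 <= X)%E.
  by apply: integral_ge0 => z _; rewrite lee_fin powR_ge0.
(* The normalising factor n + 1 of [sph_int] is at least 1 and is discarded. *)
rewrite -[leLHS]mul1e; apply: lee_wpmul2r => //.
by rewrite lee_fin ler1n.
Qed.

Lemma dyadic_shells (rho : R) : 0 < rho ->
  ~` eball (0 : Rn) rho =
  \bigcup_k @shell R n (2 ^+ k * rho) (2 ^+ k.+1 * rho).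
Proof.
move=> rho0; rewrite outside_eballE; apply/seteqP; split => [w /= hw|w [k _ /= /andP[kw _]]]; last first.
  by rewrite (le_trans _ kw)// ler_peMl ?(ltW rho0)// exprn_ege1// ler1n.
have ex : exists k, enorm w < 2 ^+ k.+1 * rho.
  have := archi_boundP (divr_ge0 (enorm_ge0 w) (ltW rho0)).
  set N := Num.bound _ => wN; exists N.
  rewrite -ltr_pdivrMr//; apply: (lt_trans wN).
  rewrite -natrX ltr_nat; apply: leq_trans (ltn_expl N.+1 (isT : 1 < 2)%N).
  exact: ltnW.
exists (ex_minn ex) => //; case: ex_minnP => k kw kmin; rewrite /shell /= kw andbT.
case: k kw kmin => [|k] kw kmin; first by rewrite expr0 mul1r.
by rewrite leNgt; apply/negP => /kmin; rewrite ltnn.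
Qed.

(** Dilation by s = 2^k rho brings the shell to 1 <= |w| < 2. The Jacobian cancels the factor
    s^-(n+1) from the weight, and what remains of the weight is at most 1. *)
Lemma osc_dyadic_shell (k : nat) (rho : R) y (M : R) : 0 < rho -> 0 <= M ->
  enorm y < 2^-1 * (2 ^+ k * rho) ->
  (modulus q Om (2 * (enorm y / (2 ^+ k * rho))) <= M%:E)%E ->
  (\int[leb]_(w in @shell R n (2 ^+ k * rho)%R (2 ^+ k.+1 * rho)%R)
     (enorm w ^- n.+1 * osc y w)%:E <= (4 ^+ n.+1 * 7 * M)%:E)%E.
Proof.
move=> rho0 M0; set s := 2 ^+ k * rho => ys yM.
have s0 : 0 < s by rewrite mulr_gt0// exprn_gt0.
have sy : enorm (s^-1 *: y) = enorm y / s.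
  by rewrite enormZ gtr0_norm ?invr_gt0// mulrC.
have ysh : enorm (s^-1 *: y) < 2^-1 by rewrite sy ltr_pdivrMr.
rewrite -sy in yM; apply: le_trans (osc_shell M0 ysh yM).
rewrite integral_mkcond [leRHS]integral_mkcond.
set S := (X in (_ \_ X)%E); set S1 := (X in (_ <= \int[_]_x (_ \_ X) x)%E).
set g := (X in (X \_ S)%E).
have mg : measurable_fun setT g.
  apply/measurable_EFinP/measurable_funM; last exact: measurable_osc.
  by apply/measurable_fun_invr/measurable_funX/measurable_enorm.
have mS : measurable S by exact: measurable_shell.
have mS1 : measurable S1 by exact: measurable_shell.
have g0 x : (0 <= (g \_ S) x)%E.
  rewrite patchE; case: ifP => // _; rewrite lee_fin mulr_ge0 ?osc_ge0//.
  by rewrite invr_ge0 exprn_ge0// enorm_ge0.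
have mgS : measurable_fun setT (g \_ S)%E.
  by apply/(measurable_restrictT _ mS)/measurable_funTS.
have sn0 : 0 < s ^+ n.+1 by rewrite exprn_gt0.
rewrite [leLHS](_ : _ = (s ^+ n.+1)%:E * \int[leb]_x (g \_ S) (s *: x)%R)%E; last first.
  by rewrite ge0_integral_scale// muleA -EFinM mulfV ?mul1e// gt_eqF.
have mgs : measurable_fun setT (fun x => (g \_ S) (s *: x)%R).
  exact: (measurableT_comp mgS (measurable_scale s)).
rewrite -ge0_integralZl//; last by rewrite lee_fin ltW.
apply: ge0_le_integral => //.
- by move=> x _; rewrite mule_ge0// lee_fin ltW.
- exact: measurable_funeM.
- apply/(measurable_restrictT _ mS1)/measurable_EFinP/measurable_funTS.
  exact: measurable_osc.
move=> x _; rewrite !patchE.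
have -> : (s *: x \in S) = (x \in S1).
  apply/idP/idP; rewrite !inE /S /S1 /shell /= enormZ gtr0_norm// exprS -mulrA -/s;
    by rewrite [2 * s]mulrC ltr_pM2l// ler_pMr.
case: ifPn => [|_]; last by rewrite mule0.
rewrite inE /S1 /shell /= => /andP[x1 x2].
rewrite /g enormZ gtr0_norm// oscZ//; last first.
  by rewrite (lt_le_trans ys)// -[leRHS]mulrC ler_pM2r//; nra.
rewrite -EFinM lee_fin mulrA ler_piMl ?osc_ge0//.
rewrite [(s * enorm x) ^+ _]exprMn invfM mulrA mulfV ?gt_eqF// mul1r.
by rewrite invf_le1 ?exprn_gt0 ?exprn_ege1// (lt_le_trans _ x1).
Qed.

(** Shifting y towards 0 by m further dyadic scales shifts the sum over shells to a tail of the Dini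
    series. By homogeneity delta does not depend on rho. *)
Lemma osc_tail (eta : R) : 0 < eta -> Lq_Dini q Om ->
  exists2 delta : R, 0 < delta & forall rho y, 0 < rho -> enorm y <= delta * rho ->
  (\int[leb]_(w in (~` eball (0%R : Rn) rho)%classic)
     (enorm w ^- n.+1 * osc y w)%:E <= eta%:E)%E.
Proof.
move=> eta0 /(dini_sum q1); pose u k := omega_q q Om (2^-1 ^+ k.+1).
move=> uoo'; have uoo : (\sum_(0 <= k <oo) u k < +oo)%E by [].
have u0 k : (0 <= u k)%E by exact: poweR_ge0.
pose C : R := 4 ^+ n.+1 * 7.
have C0 : 0 < C by rewrite mulr_gt0// exprn_gt0.
(* The bound 1 allows the modulus, a q-th power, to be replaced by [omega_q]; the bound eta / C
   makes the total at most eta. *)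
pose e := Order.min 1 (eta / C).
have e0 : 0 < e by rewrite lt_min ltr01 divr_gt0.
have [m hm] : exists m, (\sum_(m <= k <oo) u k < e%:E)%E.
  have := nneseries_tail_cvg uoo (fun k _ => u0 k).
  move=> /(_ [set x | (x < e%:E)%E]) [].
    by apply: open_nbhs_nbhs; split; [exact: open_ereal_lt_ereal|rewrite /= lte_fin].
  by move=> m _ hm; exists m; apply: (hm m) => /=.
have hmk : (\sum_(0 <= k <oo) u (k + m)%N < e%:E)%E by rewrite nneseries_addn.
have uk k : (u (k + m)%N <= e%:E)%E.
  apply: le_trans (ltW hmk); rewrite (@nneseriesD1 R (fun k => u (k + m)%N) k xpredT)//.
  by rewrite leeDl// nneseries_ge0.
have ufin k : u (k + m)%N \is a fin_num.
  by rewrite ge0_fin_numE// (le_lt_trans (uk k))// ltry.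
(* Of the two extra halvings, one absorbs the factor 2 in the argument of the modulus and the other
   matches u 0, which is taken at scale 1/2. *)
exists (2^-1 ^+ m.+2); first by rewrite exprn_gt0 ?invr_gt0.
move=> rho y rho0 yrho; rewrite dyadic_shells// ge0_integral_bigcup//; last 4 first.
- by move=> k; exact: measurable_shell.
- apply: measurable_funTS; apply/measurable_EFinP/measurable_funM; last exact: measurable_osc.
  by apply/measurable_fun_invr/measurable_funX/measurable_enorm.
- by move=> x _; rewrite lee_fin mulr_ge0 ?osc_ge0// invr_ge0 exprn_ge0// enorm_ge0.
- apply/trivIsetP => i j _ _; wlog ij : i j / (i < j)%N.
    move=> H ij; move: (ij); rewrite neq_ltn => /orP[|] ij'; first exact: H.
    by rewrite setIC; apply: H => //; rewrite eq_sym.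
  move=> _; apply/seteqP; split => // w [/= /andP[_ wi] /andP[jw _]].
  have := lt_le_trans (le_lt_trans jw wi) (lexx _).
  by rewrite ltNge ler_pM2r// ler_weXn2l// ler1n.
apply: (@le_trans _ _ (\sum_(0 <= k <oo) C%:E * u (k + m)%N)%E).
  apply: lee_nneseries => [k _ _|k _].
    apply: integral_ge0 => x _.
    by rewrite lee_fin mulr_ge0 ?osc_ge0// invr_ge0 exprn_ge0// enorm_ge0.
  rewrite -(fineK (ufin k)) -EFinM.
  have yk : enorm y / (2 ^+ k * rho) <= 2^-1 ^+ (k + m).+2.
    rewrite ler_pdivrMr; last by rewrite mulr_gt0// exprn_gt0.
    have e1 : (2^-1 : R) ^+ k * 2 ^+ k = 1 by rewrite -exprMn mulVf// expr1n.
    rewrite (le_trans yrho)// -!addnS exprD mulrACA.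
    by rewrite e1 mul1r.
  apply: osc_dyadic_shell => //; first by rewrite fine_ge0.
    rewrite -ltr_pdivrMr ?mulr_gt0 ?exprn_gt0//.
    apply: (le_lt_trans yk); rewrite exprS gtr_pMr ?invr_gt0//.
    by rewrite exprn_ilt1 ?invr_ge0// invf_lt1// ltr1n.
  rewrite fineK//; apply: (@le_trans _ _ (modulus q Om (2^-1 ^+ (k + m).+1))).
    by apply: modulus_le; rewrite -ler_pdivlMl// mulrC -exprSr.
  apply: modulus_le_omega => //.
  by rewrite (le_trans (uk k))// lee_fin ge_min lexx.
rewrite nneseriesZl// -lee_pdivlMl//; apply: (le_trans (ltW hmk)).
by rewrite -EFinM lee_fin mulrC ge_min lexx orbT.
Qed.

End oscillation.

(** * The maximal function *)

Section maximal_function.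
Context (R : realType) (n : nat).
Notation Rn := (Rn R n.+1).
Notation leb := (@leb R n.+1).
Implicit Types x y z w : Rn.
Variables (alpha : R) (Om : Rn -> R).
Hypotheses (alpha_lt : alpha < n.+1%:R) (mOm : measurable_fun setT Om).
Let a := n.+1%:R - alpha.
Let a0 : 0 < a. Proof. by rewrite subr_gt0. Qed.

Lemma measurable_eball x (r : R) : measurable (eball x r).
Proof.
apply: measurable_pred; apply: measurable_fun_ltr => //.
apply: (measurableT_comp (@measurable_enorm _ _)).
exact: measurable_sub2.
Qed.

Lemma measurable_kernel2 : measurable_fun setT (fun p : Rn * Rn => `|Om (p.1 - p.2)|).
Proof. by apply/measurableT_comp/(measurableT_comp mOm)/measurable_sub2. Qed.

Lemma measurable_kernel x : measurable_fun setT (fun y => `|Om (x - y)|).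
Proof. by apply/measurableT_comp/(measurableT_comp mOm)/measurable_sub2. Qed.

Section measurability.
Variable f : Rn -> R.
Hypothesis mf : measurable_fun setT f.

Let I (r : R) x : \bar R :=
  (\int[leb]_(y in eball x r) (`|Om (x - y)| * `|f y|)%:E)%E.

Let mk x : measurable_fun setT (fun y => (`|Om (x - y)| * `|f y|)%:E).
Proof.
apply/measurable_EFinP/measurable_funM; first exact: measurable_kernel.
exact: measurableT_comp.
Qed.

Let I_ge0 r x : (0 <= I r x)%E.
Proof. by apply: integral_ge0 => y _; rewrite lee_fin mulr_ge0. Qed.

Let I_le r s x : r <= s -> (I r x <= I s x)%E.
Proof.
move=> rs; apply: ge0_subset_integral.
- exact: measurable_eball.
- exact: measurable_eball.
- exact: measurable_funTS.
- by move=> y _; rewrite lee_fin mulr_ge0.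
- by move=> y; rewrite /eball /= => h; exact: lt_le_trans rs.
Qed.

Let mI r : measurable_fun setT (I r).
Proof.
pose H (p : Rn * Rn) : \bar R :=
  if enorm (p.2 - p.1) < r then (`|Om (p.1 - p.2)| * `|f p.2|)%:E else 0%E.
have -> : I r = fun x => (\int[leb]_y H (x, y))%E.
  apply/funext => x; rewrite /I integral_mkcond; apply: eq_integral => y _.
  by rewrite patchE /H /=; case: ifP => [|/negP h];
    [rewrite inE /eball /= => ->|case: ifP => // h'; case: h; rewrite inE].
apply: (@measurable_fun_fubini_tonelli_F _ _ _ _ R leb H).
  apply: measurable_fun_ifT => //.
    apply: measurable_fun_ltr => //; apply: (measurableT_comp (@measurable_enorm _ _)).
    exact: measurable_sub2.
  apply/measurable_EFinP/measurable_funM; first exact: measurable_kernel2.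
  apply: measurableT_comp => //; apply: (measurableT_comp mf); exact: measurable_snd.
by move=> p; rewrite /H; case: ifP => // _; rewrite lee_fin mulr_ge0.
Qed.

(** Open balls are exhausted from inside, so the ball can shrink while the weight stays at radius r.
    A radius t between s and r then does at least as well, since t^-a >= r^-a. *)
Let I_left_cvg (r : R) x (c : \bar R) : 0 < r -> (c < (r `^ (- a))%:E * I r x)%E ->
  exists2 s, 0 < s < r & (c < (r `^ (- a))%:E * I s x)%E.
Proof.
move=> r0 hc.
(* The shift by 2 keeps every s k positive. *)
pose s (k : nat) : R := r - r / k.+2%:R.
have sk k : 0 < s k < r.
  rewrite subr_gt0 ltr_pdivrMr// ltr_pMr// ltr1n /=.
  by rewrite /s ltrBlDr ltrDl divr_gt0.
have sU : \bigcup_k eball x (s k) = eball x r.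
  apply/seteqP; split => y; rewrite /eball /=.
    by case=> k _ /= h; have /andP[_] := sk k; exact: lt_trans.
  move=> h; have rh : 0 < r - enorm (y - x) by rewrite subr_gt0.
  have := archi_boundP (ltW (divr_gt0 r0 rh)).
  set K := Num.bound _ => hK; exists K => //=.
  rewrite /s ltrBrDl -ltrBrDr ltr_pdivrMr// mulrC -ltr_pdivrMr//.
  by rewrite (lt_trans hK)// ltr_nat leqW.
have snd : nondecreasing_seq (fun k => eball x (s k)).
  move=> j k jk; apply/subsetPset => y; rewrite /eball /= => h.
  apply: (lt_le_trans h); rewrite /s lerB// ler_pM2l// lef_pV2 ?posrE//.
  by rewrite ler_nat !ltnS.
have := @ge0_nondecreasing_set_cvg_integral _ _ R (fun k => eball x (s k))
  (fun y => (`|Om (x - y)| * `|f y|)%:E) leb snd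
  (fun k => measurable_eball x (s k)).
rewrite sU => /(_ _ _)/wrap[||cI].
- by move=> k; exact: measurable_funTS.
- by move=> k y _; rewrite lee_fin mulr_ge0.
have cI' : ((r `^ (- a))%:E * I (s k) x)%E @[k --> \oo] --> ((r `^ (- a))%:E * I r x)%E.
  exact: cvgeZl.
have /(cI' _) : nbhs ((r `^ (- a))%:E * I r x)%E [set u | (c < u)%E].
  exact: open_ereal_gt'.
by case=> m _ /(_ m (leqnn m)) /= hm; exists (s m).
Qed.

(** The supremum runs over uncountably many radii; left continuity reduces it to rational ones. *)
Lemma measurable_Mfun : measurable_fun setT (Mfun alpha Om f).
Proof.
apply: (measurability _ (ErealGenOInfty.measurableE R)) => //.
move=> _ [_ [c ->] <-]; rewrite setTI.
(* All rationals index the union; those that are not positive contribute the empty set. *)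
pose A (t : rat) := [set x | 0 < (ratr t : R)] `&`
  [set x | (c%:E < ((ratr t : R) `^ (- a))%:E * I (ratr t) x)%E].
rewrite (_ : _ @^-1` _ = \bigcup_t A t).
  apply: bigcupT_measurable_rat => t; apply: measurableI.
    by have [h|h] := boolP (0 < (ratr t : R));
      [rewrite (_ : [set x | _] = setT)|rewrite (_ : [set x | _] = set0)] => //;
      apply/seteqP; split.
  have mg : measurable_fun setT (fun x => ((ratr t : R) `^ (- a))%:E * I (ratr t) x)%E.
    exact: measurable_funeM.
  rewrite -[X in measurable X]setTI; apply: emeasurable_fun_o_infty => //.
apply/seteqP; split => x /=; rewrite in_itv /= andbT.
  move=> /ereal_sup_gt [_ [r r0 <-]] /(I_left_cvg r0)[s /andP[s0 sr] hs].
  have [t] := rat_in_itvoo sr; rewrite in_itv /= => /andP[st tr].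
  exists t => //; split => /=; first exact: lt_trans st.
  apply: (lt_le_trans hs); apply: lee_pmul => //.
  - by rewrite lee_fin powR_ge0.
  - rewrite lee_fin !powRN lef_pV2 ?posrE ?powR_gt0//; last exact: lt_trans st.
    by apply: ge0_ler_powR; rewrite ?nnegrE ?(ltW a0) ?ltW// (lt_trans s0 st).
  - exact/I_le/ltW.
case=> t _ [/= t0 ht]; apply: (lt_le_trans ht); apply: ereal_sup_ubound.
by exists (ratr t).
Qed.

End measurability.

Section density.
Variable W : {finite_measure set Rn -> \bar R}.
Hypothesis Wleb : W `<< leb.

(** A real-valued Radon-Nikodym density: it turns the maximal function of a measure into that of an
    integrable function, to which the operator bound applies. *)
Lemma density_exists : exists f : Rn -> R, [/\ measurable_fun setT f,
  (forall x, 0 <= f x) &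
  forall D (g : Rn -> R), measurable D -> measurable_fun setT g -> (forall x, 0 <= g x) ->
    (\int[W]_(x in D) (g x)%:E = \int[leb]_(x in D) (g x * f x)%:E)%E].
Proof.
pose F := Radon_Nikodym_SigmaFinite.f W leb.
have Ff x : F x \is a fin_num by exact: Radon_Nikodym_SigmaFinite.f_fin_num.
exists (fine \o F); split.
- apply: measurableT_comp => //; apply: measurable_int.
  exact: (Radon_Nikodym_SigmaFinite.f_integrable Wleb).
- by move=> x /=; apply: fine_ge0; exact: Radon_Nikodym_SigmaFinite.f_ge0.
- move=> D g mD mg g0.
  rewrite -(Radon_Nikodym_SigmaFinite.change_of_variables Wleb)//.
    by apply: eq_integral => x _ /=; rewrite EFinM fineK.
  exact/measurable_EFinP/measurable_funTS.
Qed.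

End density.

(** * Weak size of the kernel and the norm of Om on the sphere *)

Section kernel_weak_type.
Hypothesis hOm : homogeneous0 Om.
Let q := n.+1%:R / a.

Definition kernel x : R := Om x / enorm x `^ a.

Let kernel_norm x : `|kernel x| = `|Om x| / enorm x `^ a.
Proof. by rewrite /kernel normrM normfV (ger0_norm (powR_ge0 _ _)). Qed.

(** Solving |Om x| / |x|^a > lam for |x| gives |x| < tau x. Since q = (n+1) / a, the power tau^(n+1)
    is a multiple of |Om|^q, which links cones to the sphere norm. *)
Let tau (lam : R) x : R := (`|Om x| / lam) `^ a^-1.

Let tau_pow lam x : 0 < lam -> tau lam x ^+ n.+1 = lam `^ (- q) * `|Om x| `^ q.
Proof.
move=> l0; rewrite -powR_mulrn ?powR_ge0// /tau -powRrM [a^-1 * _]mulrC -/q.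
rewrite powRM ?invr_ge0 ?(ltW l0)// [LHS]mulrC; congr (_ * _).
by rewrite -[lam^-1]powR_inv1 ?(ltW l0)// -powRrM mulN1r.
Qed.

Let mtau lam : measurable_fun setT (tau lam).
Proof.
apply: (measurableT_comp (measurable_powR _)).
by apply: measurable_funM => //; exact: measurableT_comp.
Qed.

Let tauZ lam s x : 0 < s -> x != 0 -> tau lam (s *: x) = tau lam x.
Proof. by move=> s0 x0; rewrite /tau hOm. Qed.

Let cone_eq lam : 0 < lam ->
  [set x | lam < `|kernel x|] = [set x : Rn | 0 < enorm x < tau lam x].
Proof.
move=> l0; apply/seteqP; split => x /=; rewrite kernel_norm.
  (* At the origin the kernel is a quotient by 0, hence 0 by convention, so the origin lies in
     neither set. *)
  have [->|x0] := eqVneq x 0.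
    by rewrite enorm0 powR0 ?gt_eqF// invr0 mulr0 ltNge ltW.
  rewrite -enorm_gt0 in x0; rewrite x0 /= ltr_pdivlMr ?powR_gt0// => h.
  rewrite -[X in X < _](powRr1 (ltW x0)) -(mulfV (lt0r_neq0 a0)) powRrM /tau.
  have h' : enorm x `^ a < `|Om x| / lam by rewrite ltr_pdivlMr// mulrC.
  apply: (gt0_ltr_powR _ _ _ h'); rewrite ?invr_gt0// nnegrE ?powR_ge0//.
  by rewrite divr_ge0// ltW.
move=> /andP[x0 xt]; rewrite ltr_pdivlMr ?powR_gt0// mulrC -ltr_pdivlMr//.
have : enorm x `^ a < tau lam x `^ a.
  by apply: gt0_ltr_powR; rewrite ?nnegrE ?powR_ge0 ?(ltW x0).
by rewrite /tau -powRrM mulVf ?gt_eqF// powRr1// divr_ge0// ltW.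
Qed.

Let int_tau lam : 0 < lam ->
  (\int[leb]_(z in @pball R n) (tau lam z ^+ n.+1)%:E =
   (lam `^ (- q))%:E * \int[leb]_(z in @pball R n) (`|Om (normalize z)| `^ q)%:E)%E.
Proof.
move=> l0; rewrite -ge0_integralZl//; last 3 first.
- exact: measurable_pball.
- apply/measurable_EFinP/measurable_funTS/(measurableT_comp (measurable_powR _)).
  apply: measurableT_comp => //; apply: (measurableT_comp mOm).
  exact: measurable_normalize.
- by rewrite lee_fin powR_ge0.
apply: eq_integral => z; rewrite inE => /pballE /andP[z0 _].
by rewrite tau_pow// EFinM /normalize hOm ?invr_gt0// -enorm_gt0.
Qed.

Lemma measurable_kernel_fun : measurable_fun setT kernel.
Proof.
apply: measurable_funM => //; apply: measurable_fun_invr.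
by apply: (measurableT_comp (measurable_powR _)); exact: measurable_enorm.
Qed.

Lemma kernel_weak_le (lam : R) : 0 < lam ->
  (leb [set x | (lam < `|kernel x|)%R] <= (2 ^+ n.+1)%:E *
    ((lam `^ (- q))%:E * \int[leb]_(z in @pball R n) (`|Om (normalize z)| `^ q)%:E))%E.
Proof.
move=> l0; rewrite cone_eq// -int_tau//; apply: cone_le_integral_pball => //.
  by move=> x; exact: powR_ge0.
by move=> s x s0 x0; exact: tauZ.
Qed.

(** A single level is enough for (2), since the left side does not involve the level. *)
Lemma kernel_weak_ge :
  (\int[leb]_(z in @pball R n) (`|Om (normalize z)| `^ q)%:E <=
   (2 ^+ n.+1)%:E * leb [set x | (1 < `|kernel x|)%R])%E.
Proof.
rewrite cone_eq//.
have := int_tau ltr01; rewrite powR1 mul1e => <-.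
apply: integral_pball_le_cone => //.
  by move=> x; exact: powR_ge0.
by move=> s x s0 x0; exact: tauZ.
Qed.

End kernel_weak_type.
End maximal_function.

(** * Weak bound for the local oscillation *)

Section weak_type_oscillation.
Context (R : realType) (n : nat).
Notation Rn := (Rn R n.+1).
Notation leb := (@leb R n.+1).
Implicit Types x y z w : Rn.
Variables (alpha : R) (Om : Rn -> R).
Hypotheses (alpha_ge0 : 0 <= alpha) (alpha_lt : alpha < n.+1%:R).
Hypothesis mOm : measurable_fun setT Om.
Let a := n.+1%:R - alpha.
Let q := n.+1%:R / a.
Let a0 : 0 < a. Proof. by rewrite subr_gt0. Qed.
Let q1 : 1 <= q.
Proof. by rewrite ler_pdivlMr// mul1r lerBlDr lerDl. Qed.
Let aq : a * q = n.+1%:R.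
Proof. by rewrite mulrC divfK// gt_eqF. Qed.

Lemma powR_neg_le (x y b : R) : 0 <= b -> 0 < x -> x <= y ->
  y `^ (- b) <= x `^ (- b).
Proof.
move=> b0 x0 xy; have y0 := lt_le_trans x0 xy.
rewrite !powRN lef_pV2 ?posrE ?powR_gt0//.
by apply: ge0_ler_powR; rewrite ?nnegrE ?(ltW x0) ?(ltW y0).
Qed.

(** If b > eta, then (b / eta)^(p-1) >= 1 and the second term alone dominates b. *)
Lemma le_eta_powR (b eta p : R) : 0 < eta -> 1 <= p -> 0 <= b ->
  b <= eta + eta `^ (1 - p) * b `^ p.
Proof.
move=> e0 p1 b0; have [be|eb] := leP b eta.
  by rewrite (le_trans be)// lerDl mulr_ge0 ?powR_ge0.
have b0' := lt_trans e0 eb.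
apply: (@le_trans _ _ (eta `^ (1 - p) * b `^ p)); last by rewrite lerDr ltW.
rewrite -{1}[b](powRr1 b0) -[X in b `^ X](subrK p 1) powRD; last first.
  by rewrite (gt_eqF b0') implybT.
rewrite ler_wpM2r ?powR_ge0// -opprB.
by apply: powR_neg_le; rewrite ?subr_ge0// ltW.
Qed.

Variable W : {finite_measure set Rn -> \bar R}.
Variables (rho eps m' eta' : R).
Hypotheses (rho0 : 0 < rho) (m'0 : 0 < m') (Wm' : (W setT <= m'%:E)%E).

Let B : set Rn := eball 0 eps.

Definition local_osc x : \bar R := (\int[W]_(y in B) (`|Om (x - y) - Om x|)%:E)%E.

Let H x : \bar R := (\int[W]_(y in B) (osc q Om y x)%:E)%E.

Let mB : measurable B. Proof. exact: measurable_eball. Qed.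

Let WB : (W B <= m'%:E)%E.
Proof. by apply: le_trans Wm'; apply: le_measure; rewrite ?inE. Qed.

Let mdiff2 : measurable_fun setT (fun p : Rn * Rn => `|Om (p.1 - p.2) - Om p.1|).
Proof.
apply: measurableT_comp => //; apply: measurable_funB; apply: (measurableT_comp mOm) => //.
exact: measurable_sub2.
Qed.

Lemma measurable_diff x : measurable_fun setT (fun y => `|Om (x - y) - Om x|).
Proof.
apply: measurableT_comp => //; apply: measurable_funB => //.
by apply: (measurableT_comp mOm); exact: measurable_sub2.
Qed.

Let measurable_int2 (h : Rn * Rn -> R) : measurable_fun setT h ->
  (forall p, 0 <= h p) ->
  measurable_fun setT (fun x => \int[W]_(y in B) (h (x, y))%:E)%E.
Proof.
move=> mh h0; pose h' (p : Rn * Rn) : \bar R :=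
  if enorm (p.2 - 0) < eps then (h p)%:E else 0%E.
rewrite (_ : (fun x => _) = fun x => (\int[W]_y h' (x, y))%E).
  apply: (@measurable_fun_fubini_tonelli_F _ _ _ _ R W h').
    apply: measurable_fun_ifT => //; last exact/measurable_EFinP.
    apply: measurable_fun_ltr => //; apply: (measurableT_comp (@measurable_enorm _ _)).
    by apply: measurable_sub2.
  by move=> p; rewrite /h'; case: ifP => // _; rewrite lee_fin.
apply/funext => x; rewrite integral_mkcond; apply: eq_integral => y _.
rewrite patchE /h' /=; case: ifP => [|/negP h1].
  by rewrite inE /B /eball /= => ->.
by case: ifP => // h2; case: h1; rewrite inE.
Qed.

Lemma measurable_local_osc : measurable_fun setT local_osc.
Proof.
exact: (measurable_int2 (h := fun p : Rn * Rn => `|Om (p.1 - p.2) - Om p.1|)).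
Qed.

Let mH : measurable_fun setT H.
Proof.
apply: (measurable_int2 (h := fun p : Rn * Rn => osc q Om p.2 p.1)).
  exact: measurable_osc2.
by move=> p; exact: osc_ge0.
Qed.

(* With eta = |x|^a lam / m', integrating b <= eta + eta^(1-q) b^q replaces the
   use of Jensen's inequality. *)
Let local_osc_bound (lam : R) x : 0 < lam -> 0 < enorm x ->
  ((enorm x `^ (- a))%:E * local_osc x <= lam%:E +
   (lam `^ (1 - q) * (m' `^ (q - 1) * enorm x ^- n.+1))%:E * H x)%E.
Proof.
move=> l0 x0; pose et := enorm x `^ a * lam / m'.
have et0 : 0 < et by rewrite divr_gt0// mulr_gt0// powR_gt0.
have H0 : (0 <= H x)%E by apply: integral_ge0 => y _; rewrite lee_fin osc_ge0.
have mo : measurable_fun setT (fun y => (osc q Om y x)%:E).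
  apply/measurable_EFinP/(measurableT_comp (measurable_powR _)).
  exact: measurable_diff.
have h1 : (local_osc x <= et%:E * W B + (et `^ (1 - q))%:E * H x)%E.
  rewrite /H -ge0_integralZl//; last 3 first.
  - exact: measurable_funTS.
  - by move=> y _; rewrite lee_fin osc_ge0.
  - by rewrite lee_fin powR_ge0.
  rewrite -integral_cst// -ge0_integralD//; last 3 first.
  - by move=> y _; rewrite lee_fin ltW.
  - by move=> y _; rewrite mule_ge0 ?lee_fin ?powR_ge0 ?osc_ge0.
  - by apply: measurable_funTS; exact: measurable_funeM.
  apply: ge0_le_integral => //.
  - by apply/measurable_funTS/measurable_EFinP; exact: measurable_diff.
  - apply: emeasurable_funD => //.
    by apply: measurable_funTS; exact: measurable_funeM.
  - move=> y _; rewrite -EFinM -EFinD lee_fin.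
    by apply: le_eta_powR.
have xa0 : 0 < enorm x `^ (- a) by rewrite powR_gt0.
apply: (@le_trans _ _ ((enorm x `^ (- a))%:E *
    ((et * m')%:E + (et `^ (1 - q))%:E * H x))%E).
  apply: lee_wpmul2l; first by rewrite lee_fin ltW.
  apply: (le_trans h1); apply: leeD => //.
  by rewrite [(et * m')%:E]EFinM; apply: lee_wpmul2l => //; rewrite lee_fin ltW.
have em0 : (0 <= (et * m')%:E)%E by rewrite lee_fin mulr_ge0// ltW.
have eH0 : (0 <= (et `^ (1 - q))%:E * H x)%E by rewrite mule_ge0// lee_fin powR_ge0.
rewrite (ge0_muleDr _ em0 eH0) [X in (_ + X <= _)%E]muleA -!EFinM.
have -> : enorm x `^ (- a) * (et * m') = lam.
  by rewrite /et divfK ?gt_eqF// mulrA powRN mulVf ?mul1r// gt_eqF// powR_gt0.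
have -> : enorm x `^ (- a) * et `^ (1 - q) =
    lam `^ (1 - q) * (m' `^ (q - 1) * enorm x ^- n.+1); last by [].
have -> : enorm x ^- n.+1 = enorm x `^ (- a) * enorm x `^ (a * (1 - q)).
  rewrite -powRD; last by rewrite (gt_eqF x0) implybT.
  by rewrite mulrBr mulr1 aq addrA addNr add0r powR_invn// ltW.
rewrite /et powRM ?invr_ge0 ?mulr_ge0 ?powR_ge0 ?(ltW l0) ?(ltW m'0)//.
rewrite powRM ?powR_ge0 ?(ltW l0)// -powRrM.
have -> : m'^-1 `^ (1 - q) = m' `^ (q - 1).
  by rewrite -[m'^-1]powR_inv1 ?ltW// -powRrM mulN1r opprB.
by rewrite !mulrA; ring.
Qed.

Hypothesis eta'0 : 0 <= eta'.
Hypothesis osc_small : forall y, B y ->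
  (\int[leb]_(w in (~` eball (0%R : Rn) rho)%classic)
     (enorm w ^- n.+1 * osc q Om y w)%:E <= eta'%:E)%E.

(** At level lam / 2 the pointwise bound absorbs half of lam and leaves g >= (lam / 2)^q on the set
    in question, so Chebyshev's inequality applies to g. *)
Lemma local_osc_weak (lam : R) : 0 < lam ->
  (leb ((~` eball (0%R : Rn) rho) `&`
     [set x | (lam%:E < (enorm x `^ (- a))%:E * local_osc x)%E])
   <= ((2 / lam) `^ q * (m' `^ q * eta'))%:E)%E.
Proof.
move=> l0; set E := (~` eball (0%R : Rn) rho)%classic.
have mE : measurable E by exact: measurable_outside.
pose g x := ((m' `^ (q - 1))%:E * ((enorm x ^- n.+1)%:E * H x))%E.
have H0 x : (0 <= H x)%E by apply: integral_ge0 => y _; rewrite lee_fin osc_ge0.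
have e0 x : 0 <= enorm x ^- n.+1 by rewrite invr_ge0 exprn_ge0// enorm_ge0.
have mgi : measurable_fun setT (fun x => (enorm x ^- n.+1)%:E * H x)%E.
  apply: emeasurable_funM => //.
  by apply/measurable_EFinP/measurable_fun_invr/measurable_funX/measurable_enorm.
have mg : measurable_fun setT g by exact: measurable_funeM.
have g0 x : (0 <= g x)%E by rewrite /g !mule_ge0// lee_fin ?powR_ge0.
have l20 : 0 < lam / 2 by rewrite divr_gt0.
pose L := (lam / 2) `^ q.
have L0 : 0 < L by rewrite powR_gt0.
have sub : E `&` [set x | (lam%:E < (enorm x `^ (- a))%:E * local_osc x)%E] `<=`
    E `&` [set x | (L%:E <= `|g x|)%E].
  move=> x [Ex] /= hx; split => //=; rewrite gee0_abs//.
  have x0 : 0 < enorm x.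
    by apply: lt_le_trans rho0 _; move: Ex; rewrite /E outside_eballE.
  have := lt_le_trans hx (local_osc_bound l20 x0).
  have Hg : ((m' `^ (q - 1) * enorm x ^- n.+1)%:E * H x = g x)%E.
    by rewrite /g muleA -EFinM.
  rewrite [((lam / 2) `^ (1 - q) * _)%:E]EFinM -muleA Hg => h.
  rewrite [X in (_ < X + _)%E](_ : _ = lam%:E - (lam / 2)%:E)%E in h; last first.
    by rewrite -EFinB; congr (_%:E); field.
  have h' : ((lam / 2)%:E <= ((lam / 2) `^ (1 - q))%:E * g x)%E.
    move: h; case: (((lam / 2) `^ (1 - q))%:E * g x)%E => [r||] //=.
    - by rewrite -EFinB -EFinD !lte_fin lee_fin => h; lra.
    - by rewrite leey.
  have -> : L%:E = (((lam / 2) `^ (q - 1))%:E * (lam / 2)%:E)%E.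
    rewrite /L -EFinM; congr (_%:E).
    by rewrite [RHS]mulrC mulr_powRB1// ?ltW// (lt_le_trans _ q1).
  apply: le_trans (lee_wpmul2l _ h') _; first by rewrite lee_fin powR_ge0.
  rewrite muleA -EFinM -powRD; last by rewrite (gt_eqF l20) implybT.
  by rewrite addrA subrK subrr powRr0 mul1e.
have mD : measurable_fun setT (fun x => (enorm x `^ (- a))%:E * local_osc x)%E.
  apply: emeasurable_funM; last exact: measurable_local_osc.
  by apply/measurable_EFinP/(measurableT_comp (measurable_powR _))/measurable_enorm.
have mS1 : measurable (E `&` [set x | (lam%:E < (enorm x `^ (- a))%:E * local_osc x)%E]).
  apply: emeasurable_fun_o_infty => //; exact: measurable_funTS.
have mS2 : measurable (E `&` [set x | (L%:E <= `|g x|)%E]).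
  apply: emeasurable_fun_c_infty => //; apply: measurableT_comp => //.
  exact: measurable_funTS.
apply: (@le_trans _ _ (leb (E `&` [set x | (L%:E <= `|g x|)%E]))).
  by apply: le_measure; rewrite ?inE.
have cheb := le_integral_abse leb mE (measurable_funTS mg) L0.
(* With x integrated first, each y in B contributes at most eta'; integrating over B adds a factor
   m', and m'^(q-1) m' = m'^q. *)
have int_g : (\int[leb]_(x in E) `|g x| <= (m' `^ q * eta')%:E)%E.
  under eq_integral => x _ do rewrite gee0_abs//.
  rewrite /g ge0_integralZl//; last 3 first.
  - exact: measurable_funTS.
  - by move=> x _; rewrite mule_ge0// lee_fin.
  - by rewrite lee_fin powR_ge0.
  pose G (p : Rn * Rn) : \bar R :=
    if (rho <= enorm p.1) && (enorm (p.2 - 0) < eps)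
    then (enorm p.1 ^- n.+1 * osc q Om p.2 p.1)%:E else 0%E.
  have mo2 : measurable_fun setT (fun p : Rn * Rn => osc q Om p.2 p.1).
    exact: measurable_osc2.
  have m1 : measurable_fun setT (fun p : Rn * Rn => enorm p.1).
    by apply: (measurableT_comp (@measurable_enorm _ _)); exact: measurable_fst.
  have mG : measurable_fun setT G.
    apply: measurable_fun_ifT => //.
      apply: measurable_and; first exact: measurable_fun_ler.
      apply: measurable_fun_ltr => //; apply: (measurableT_comp (@measurable_enorm _ _)).
      by apply: measurable_sub2.
    apply/measurable_EFinP/measurable_funM => //.
    by apply/measurable_fun_invr/measurable_funX.
  have G0 p : (0 <= G p)%E.
    by rewrite /G; case: ifP => // _; rewrite lee_fin mulr_ge0 ?osc_ge0.
  have EP x : E x <-> (rho <= enorm x) by rewrite /E outside_eballE.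
  have -> : (\int[leb]_(x in E) ((enorm x ^- n.+1)%:E * H x) =
      \int[leb]_x \int[W]_y G (x, y))%E.
    rewrite integral_mkcond; apply: eq_integral => x _; rewrite patchE.
    case: ifPn => [|]; last first.
      rewrite notin_setE => h; rewrite integral0_eq// => y _; rewrite /G /=.
      by case: ifP => // /andP[/EP].
    rewrite inE => /EP hx; rewrite /H -ge0_integralZl//; last 3 first.
    - apply/measurable_funTS/measurable_EFinP.
      apply/(measurableT_comp (measurable_powR _)); exact: measurable_diff.
    - by move=> y _; rewrite lee_fin osc_ge0.
    - by rewrite lee_fin.
    rewrite integral_mkcond; apply: eq_integral => y _.
    rewrite patchE /G /= hx /=; case: ifP => [|/negP h1].
      by rewrite inE /B /eball /= => ->.
    by case: ifP => // h2; case: h1; rewrite inE.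
  rewrite (@fubini_tonelli _ _ _ _ R leb W G)//.
  have le1 : (\int[W]_y \int[leb]_x G (x, y) <= \int[W]_(y in B) cst eta'%:E y)%E.
    rewrite [leRHS]integral_mkcond; apply: ge0_le_integral => //.
    - by move=> y _; exact: integral_ge0.
    - exact: (@measurable_fun_fubini_tonelli_G _ _ _ _ R leb G).
    - exact/(measurable_restrictT _ mB).
    move=> y _; rewrite patchE; case: ifPn => [|].
      rewrite inE => hy; apply: le_trans (osc_small hy).
      rewrite [leRHS]integral_mkcond le_eqVlt; apply/orP; left; apply/eqP.
      apply: eq_integral => x _; rewrite patchE /G /=.
      move: hy; rewrite /B /eball /= => ->; rewrite andbT.
      case: ifP => [/EP h|/negP h]; first by rewrite mem_set.
      by rewrite memNset// => /EP.
    rewrite notin_setE => h; rewrite integral0_eq// => x _; rewrite /G /=.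
    by case: ifP => // /andP[_ h2]; case: h.
  rewrite integral_cst// in le1.
  apply: (@le_trans _ _ ((m' `^ (q - 1))%:E * (eta'%:E * m'%:E))%E).
    apply: lee_wpmul2l; first by rewrite lee_fin powR_ge0.
    by apply: (le_trans le1); apply: lee_wpmul2l.
  rewrite -!EFinM lee_fin [eta' * _]mulrC mulrA [_ * m']mulrC.
  by rewrite mulr_powRB1// ?ltW// (lt_le_trans _ q1).
have := le_trans cheb int_g.
have -> : (2 / lam) `^ q = L^-1.
  rewrite -invf_div -[(lam / 2)^-1]powR_inv1 ?(ltW l20)//.
  by rewrite -powRrM mulN1r powRN.
by rewrite [in X in _ -> X]EFinM -lee_pdivlMl.
Qed.

End weak_type_oscillation.

(** * Pointwise comparison of the maximal function with the kernel *)

Section pointwise_comparison.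
Context (R : realType) (n : nat).
Notation Rn := (Rn R n.+1).
Notation leb := (@leb R n.+1).
Implicit Types x y z w : Rn.

(** The factor 1 + eta is meant for the main term and the crude factor 2^a for the error term. The
    lower bound comes from 1 / (1 + eta) >= 1 - eta. *)
Lemma powR_shift (a eta : R) : 0 < a -> 0 < eta -> eta <= 1 ->
  exists2 th : R, 0 < th < 1 & forall X e : R, 0 < X -> 0 <= e -> e <= th * X ->
  [/\ e < X, (X - e) `^ (- a) <= X `^ (- a) * (1 + eta),
      (X - e) `^ (- a) <= 2 `^ a * X `^ (- a) &
      X `^ (- a) * (1 - eta) <= (X + e) `^ (- a)].
Proof.
move=> a0 eta0 eta1; have e10 : 0 < 1 + eta by rewrite addr_gt0.
pose b := (1 + eta) `^ a^-1; pose c := (1 + eta) `^ (- a^-1).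
have b1 : 1 < b.
  suff : 1 `^ a^-1 < (1 + eta) `^ a^-1 by rewrite powR1.
  by apply: gt0_ltr_powR; rewrite ?invr_gt0 ?nnegrE ?(ltW e10) ?ltrDl.
have cb : c = b^-1 by rewrite /c powRN.
have b0 : 0 < b by rewrite (lt_trans _ b1).
have c0 : 0 < c by rewrite cb invr_gt0.
have c1 : c < 1 by rewrite cb invf_lt1.
have ba : b `^ a = 1 + eta by rewrite /b -powRrM mulVf ?gt_eqF// powRr1// ltW.
have ca : c `^ (- a) = 1 + eta.
  by rewrite /c -powRrM mulrNN mulVf ?gt_eqF// powRr1// ltW.
(* The three entries give X - e >= X / 2, X - e >= c X and X + e <= b X. *)
exists (Num.min 2^-1 (Num.min (1 - c) (b - 1))).
  rewrite !lt_min !subr_gt0 c1 b1 invr_gt0 ltr0n /=.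
  by rewrite gt_min; apply/orP; left; rewrite invf_lt1// ltr1n.
set th := Num.min _ _ => X e X0 e0 eX.
have th1 : th <= 2^-1 by rewrite ge_min lexx.
have th2 : th <= 1 - c by rewrite !ge_min lexx orbT.
have th3 : th <= b - 1 by rewrite !ge_min lexx !orbT.
have eX1 : e <= 2^-1 * X by rewrite (le_trans eX)// ler_wpM2r// ltW.
have eX2 : e <= (1 - c) * X by rewrite (le_trans eX)// ler_wpM2r// ltW.
have eX3 : e <= (b - 1) * X by rewrite (le_trans eX)// ler_wpM2r// ltW.
split.
- by apply: (le_lt_trans eX1); rewrite gtr_pMl// invf_lt1// ltr1n.
- apply: (@le_trans _ _ ((c * X) `^ (- a))).
    apply: powR_neg_le; rewrite ?(ltW a0)// ?mulr_gt0//.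
    by rewrite lerBrDr -lerBrDl -[X in X - _]mul1r -mulrBl.
  by rewrite powRM ?(ltW c0) ?(ltW X0)// ca mulrC.
- apply: (@le_trans _ _ ((2^-1 * X) `^ (- a))).
    apply: powR_neg_le; rewrite ?(ltW a0)// ?mulr_gt0//.
    rewrite lerBrDr -lerBrDl -[X in X - _]mul1r -mulrBl.
    by rewrite (_ : 1 - 2^-1 = 2^-1 :> R)//; field.
  rewrite powRM ?invr_ge0 ?(ltW X0)//.
  by rewrite -[(2^-1)]powR_inv1// -powRrM mulrNN mul1r.
- apply: (@le_trans _ _ ((b * X) `^ (- a))); last first.
    apply: powR_neg_le; rewrite ?(ltW a0)//; first exact: ltr_wpDr.
    by rewrite -lerBrDl -[X in _ - X]mul1r -mulrBl.
  rewrite powRM ?(ltW b0) ?(ltW X0)// mulrC ler_wpM2r ?powR_ge0//.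
  rewrite powRN ba -(ler_pM2r e10) mulVf ?gt_eqF//.
  by rewrite -subr_sqr expr1n gerBl sqr_ge0.
Qed.

Variables (alpha : R) (Om : Rn -> R).
Hypotheses (alpha_lt : alpha < n.+1%:R) (mOm : measurable_fun setT Om).
Let a := n.+1%:R - alpha.
Let a0 : 0 < a. Proof. by rewrite subr_gt0. Qed.

Variable W : {finite_measure set Rn -> \bar R}.
Variable f : Rn -> R.
Hypotheses (mf : measurable_fun setT f) (f0 : forall x, 0 <= f x).
Hypothesis fE : forall D (g : Rn -> R), measurable D -> measurable_fun setT g ->
  (forall x, 0 <= g x) ->
  (\int[W]_(x in D) (g x)%:E = \int[leb]_(x in D) (g x * f x)%:E)%E.

Lemma Mmeas_density : Mmeas alpha Om W = Mfun alpha Om f.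
Proof.
apply/funext => x; rewrite /Mmeas /Mfun; congr ereal_sup.
apply: eq_imagel => r _; congr (_ * _)%E.
rewrite fE//.
- by apply: eq_integral => y _; rewrite (ger0_norm (f0 y)).
- exact: measurable_eball.
- exact: measurable_kernel.
Qed.

Lemma L1norm_density : L1norm f = W setT.
Proof.
rewrite /L1norm -[RHS]mul1e -integral_cst// (fE (g := cst 1))//.
by apply: eq_integral => y _; rewrite /= mul1r ger0_norm.
Qed.

Variable eps : R.
Let B : set Rn := eball 0 eps.
Let mB : measurable B. Proof. exact: measurable_eball. Qed.

Definition far_part y : R := if eps <= enorm y then f y else 0.

Lemma measurable_far_part : measurable_fun setT far_part.
Proof.
apply: measurable_fun_ifT => //; apply: measurable_fun_ler => //.
exact: measurable_enorm.
Qed.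

Lemma L1norm_far_part : L1norm far_part = W (~` B).
Proof.
have mBc : measurable (~` B) by exact: measurableC.
rewrite /L1norm -[RHS]mul1e -integral_cst// (fE (g := cst 1))//.
rewrite [RHS]integral_mkcond; apply: eq_integral => y _.
rewrite patchE /far_part (_ : (y \in ~` B) = (eps <= enorm y)).
  by case: ifP => _; rewrite /= ?mul1r ?normr0// ger0_norm.
by apply/idP/idP; rewrite inE outside_eballE.
Qed.

Let k x y : R := `|Om (x - y)|.
Let IB x : \bar R := (\int[W]_(y in B) (k x y)%:E)%E.

Let mk x : measurable_fun setT (fun y => (k x y)%:E).
Proof. by apply/measurable_EFinP; exact: measurable_kernel. Qed.

Let k_ge0 x y : (0 <= (k x y)%:E)%E.
Proof. by rewrite lee_fin /k. Qed.

Let mdiff x : measurable_fun B (fun y => (`|Om (x - y) - Om x|)%:E).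
Proof. by apply/measurable_funTS/measurable_EFinP; exact: measurable_diff. Qed.

Let mkB x : measurable_fun B (fun y => (k x y)%:E).
Proof. exact: measurable_funTS. Qed.

Let Mmeas_upper x : eps < enorm x ->
  (Mmeas alpha Om W x <= ((enorm x - eps) `^ (- a))%:E * IB x + Mfun alpha Om far_part x)%E.
Proof.
move=> ex; apply: ge_ereal_sup => _ [r /= r0 <-].
have mA : measurable (eball x r) by exact: measurable_eball.
have mAB : measurable (eball x r `&` B) by exact: measurableI.
have mAD : measurable (eball x r `\` B) by exact: measurableD.
have rr0 : (0 <= (r `^ (- a))%:E)%E by rewrite lee_fin powR_ge0.
rewrite -{1}(setUIDK (eball x r) B).
rewrite (@ge0_integral_setU _ _ _ W _ _ mAB mAD (fun y => (k x y)%:E)); last 3 first.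
- exact: (measurable_funTS (mk x)).
- by move=> y _; exact: k_ge0.
- by apply/disj_setPS => y [[_ yB] []].
rewrite ge0_muleDr; [|exact: integral_ge0|exact: integral_ge0].
apply: leeD.
  have [rx|rx] := leP r (enorm x - eps).
    rewrite (_ : eball x r `&` B = set0); last first.
      apply/seteqP; split=> // y []; rewrite /B /eball /= subr0 => yx ye.
      have := enorm_subr x y; rewrite enormB => h; lra.
    by rewrite integral_set0 mule0 mule_ge0// ?lee_fin ?powR_ge0// integral_ge0.
  apply: lee_pmul => //; first exact: integral_ge0.
    by rewrite lee_fin; apply: powR_neg_le; [exact: ltW|lra|exact: ltW].
  by apply: ge0_subset_integral => //; exact: measurable_funTS.
have -> : (\int[W]_(y in eball x r `\` B) (k x y)%:E =
    \int[leb]_(y in eball x r `\` B) (k x y * f y)%:E)%E.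
  by apply: fE; [exact: mAD|exact: measurable_kernel|move=> y; rewrite /k].
apply: (@le_trans _ _ ((r `^ (- a))%:E *
  \int[leb]_(y in eball x r) (k x y * `|far_part y|)%:E)%E); last first.
  by apply: ereal_sup_ubound; exists r.
apply: lee_wpmul2l => //.
have mkf : measurable_fun setT (fun y => (k x y * `|far_part y|)%:E).
  apply/measurable_EFinP/measurable_funM; first exact: measurable_kernel.
  by apply: measurableT_comp => //; exact: measurable_far_part.
apply: (@le_trans _ _ (\int[leb]_(y in eball x r `\` B) (k x y * `|far_part y|)%:E)%E).
  rewrite le_eqVlt; apply/orP; left; apply/eqP; apply: eq_integral => y.
  rewrite inE => -[_ yB]; have : (~` B) y by [].
  by rewrite outside_eballE /far_part /= => ->; rewrite ger0_norm.
apply: ge0_subset_integral => //.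
- exact: measurable_funTS.
- by move=> y _; rewrite lee_fin mulr_ge0// /k.
Qed.

(** One radius is enough: the ball of radius |x| + eps about x contains B. *)
Let Mmeas_lower x : 0 < eps ->
  (((enorm x + eps) `^ (- a))%:E * IB x <= Mmeas alpha Om W x)%E.
Proof.
move=> e0; apply: (@le_trans _ _ (((enorm x + eps) `^ (- a))%:E *
  \int[W]_(y in eball x (enorm x + eps)) (k x y)%:E)%E); last first.
  by apply: ereal_sup_ubound; exists (enorm x + eps) => //=; rewrite ltr_wpDl ?enorm_ge0.
apply: lee_wpmul2l; first by rewrite lee_fin powR_ge0.
apply: ge0_subset_integral; first exact: mB.
- exact: measurable_eball.
- exact: (measurable_funTS (mk x)).
- by move=> y _; exact: k_ge0.
move=> y; rewrite /B /eball /= subr0 => ye.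
by rewrite (le_lt_trans (enormD _ _))// enormN addrC ltrD2l.
Qed.

Let IB_upper x : (IB x <= `|Om x|%:E * W B + local_osc Om W eps x)%E.
Proof.
rewrite /IB /local_osc -integral_cst// -ge0_integralD; last 5 first.
- exact: mB.
- by move=> y _; rewrite lee_fin.
- exact: measurable_cst.
- by move=> y _; rewrite lee_fin.
- exact: mdiff.
apply: ge0_le_integral; first exact: mB.
- by move=> y _; exact: k_ge0.
- exact: mkB.
- by apply: emeasurable_funD; [exact: measurable_cst|exact: mdiff].
move=> y _; rewrite /= -EFinD lee_fin /k.
by rewrite -[leLHS](_ : `|Om x + (Om (x - y) - Om x)| = _) ?ler_normD// addrC subrK.
Qed.

Let IB_lower x : (`|Om x|%:E * W B <= IB x + local_osc Om W eps x)%E.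
Proof.
rewrite /IB /local_osc -integral_cst// -ge0_integralD//.
apply: ge0_le_integral; first exact: mB.
- by move=> y _; rewrite lee_fin.
- exact: measurable_cst.
- by apply: emeasurable_funD; [exact: mkB|exact: mdiff].
move=> y _; rewrite /= -EFinD lee_fin /k.
have := ler_normB (Om (x - y)) (Om (x - y) - Om x).
by rewrite opprB addrCA subrr addr0.
Qed.

(** The arithmetic core, over the reals. M is the maximal function, M2 its far part, i the integral
    over B, d the local oscillation, o = |Om x|, P = |x|^-a, w and m the masses of B and of the
    whole space, u and v the weights at |x| - eps and |x| + eps, and t = 2^a. *)
Lemma real_comparison (M2 d i o w m u v P eta t M : R) :
  0 <= M2 -> 0 <= d -> 0 <= o -> 0 <= w -> 0 <= P -> 0 <= eta -> eta <= 1 -> 1 <= t ->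
  0 <= u -> 0 <= v ->
  u <= P * (1 + eta) -> u <= t * P -> P * (1 - eta) <= v -> v <= P ->
  w <= m -> m - eta <= w -> M <= u * i + M2 -> v * i <= M ->
  i <= o * w + d -> o * w <= i + d ->
  `|M - o * P * m| <= M2 + eta * (m + 1) * (o * P) + t * (P * d).
Proof.
move=> M20 d0 o0 w0 P0 eta0 eta1 t1 u0 v0 u1 u2 v1 v2 wm mw Mu vM iw wi.
have ow0 : 0 <= o * w by exact: mulr_ge0.
have h1 : u * i <= u * (o * w) + u * d by rewrite -mulrDr ler_wpM2l.
have h2 : u * d <= t * P * d by rewrite ler_wpM2r.
have h3 : u * (o * w) <= P * (1 + eta) * (o * m).
  by apply: ler_pM => //; rewrite ler_wpM2l.
have h4 : v * (o * w) <= v * i + v * d by rewrite -mulrDr ler_wpM2l.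
have h5 : v * d <= P * d by rewrite ler_wpM2r.
have h6 : P * d <= t * (P * d) by rewrite ler_peMl// mulr_ge0.
have h7 : P * (1 - eta) * (o * w) <= v * (o * w) by rewrite ler_wpM2r.
have c0 : 0 <= P * (1 - eta) * o.
  by rewrite !mulr_ge0// subr_ge0.
have h8 : P * (1 - eta) * o * (m - eta) <= P * (1 - eta) * o * w by rewrite ler_wpM2l.
have h9 : 0 <= P * o * eta ^+ 2 by rewrite !mulr_ge0// sqr_ge0.
have h10 : 0 <= o * P * eta by rewrite !mulr_ge0.
have e1 : P * (1 + eta) * (o * m) = o * P * m + eta * m * (o * P) by ring.
have e2 : P * (1 - eta) * o * (m - eta) =
  o * P * m - eta * (m + 1) * (o * P) + P * o * eta ^+ 2 by ring.
have e3 : P * (1 - eta) * o * w = P * (1 - eta) * (o * w) by ring.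
have e4 : eta * (m + 1) * (o * P) = eta * m * (o * P) + o * P * eta by ring.
have e5 : t * P * d = t * (P * d) by ring.
rewrite ler_norml; apply/andP; split;
  clear - M20 Mu vM h1 h2 h3 h4 h5 h6 h7 h8 h9 h10 e1 e2 e3 e4 e5; lra.
Qed.

Lemma pointwise_comparison (eta : R) x :
  0 < eta -> eta <= 1 -> 0 < eps -> eps < enorm x ->
  (enorm x - eps) `^ (- a) <= enorm x `^ (- a) * (1 + eta) ->
  (enorm x - eps) `^ (- a) <= 2 `^ a * enorm x `^ (- a) ->
  enorm x `^ (- a) * (1 - eta) <= (enorm x + eps) `^ (- a) ->
  (W (~` B) <= eta%:E)%E ->
  (`|Mmeas alpha Om W x - (`|Om x| / enorm x `^ a)%:E * W setT| <=
   Mfun alpha Om far_part x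
   + (eta * (fine (W setT) + 1) * (`|Om x| / enorm x `^ a))%:E
   + (2 `^ a)%:E * ((enorm x `^ (- a))%:E * local_osc Om W eps x))%E.
Proof.
move=> eta0 eta1 e0 ex u1 u2 v1 WBc.
have x0 : 0 < enorm x by rewrite (lt_trans e0).
have fW A : measurable A -> W A \is a fin_num by move=> mA; exact: fin_num_measure.
have P0 : 0 < enorm x `^ (- a) by rewrite powR_gt0.
have t0 : 0 < (2 : R) `^ a by rewrite powR_gt0.
have D0 : (0 <= local_osc Om W eps x)%E by apply: integral_ge0 => y _; rewrite lee_fin.
have M0 : (0 <= Mfun alpha Om far_part x)%E.
  apply: (@le_trans _ _ ((1 `^ (- a))%:E *
     \int[leb]_(y in eball x 1%R) (`|Om (x - y)| * `|far_part y|)%:E)%E).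
    by rewrite mule_ge0 ?lee_fin ?powR_ge0// integral_ge0// => y _; rewrite lee_fin mulr_ge0.
  by apply: ereal_sup_ubound; exists 1 => /=.
have MW0 : (0 <= Mmeas alpha Om W x)%E.
  apply: le_trans (Mmeas_lower x e0); rewrite mule_ge0 ?lee_fin ?powR_ge0//.
  by apply: integral_ge0 => y _; exact: k_ge0.
have I0 : (0 <= IB x)%E by apply: integral_ge0 => y _; exact: k_ge0.
have k0 : 0 <= eta * (fine (W setT) + 1) * (`|Om x| / enorm x `^ a).
  by rewrite !mulr_ge0 ?invr_ge0 ?powR_ge0 ?(ltW eta0)// addr_ge0// fine_ge0.
have hU := Mmeas_upper ex; have hL := Mmeas_lower x e0.
have iU := IB_upper x; have iL := IB_lower x.
have WT : W setT = (W B + W (~` B))%E.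
  by rewrite -measureU ?setUv// ?setICr//; exact: measurableC.
move: hU hL iU iL M0 MW0 I0 D0.
have := fineK (fW _ mB); have := fineK (fW _ (measurableC mB)).
have := fineK (fW _ measurableT); move: WT WBc.
set w := fine (W B); set wc := fine (W (~` B)); set m := fine (W setT).
move=> + + mE wcE wE; rewrite -mE -wE -wcE -EFinD lee_fin => -[mw] wce.
(* If the oscillation or the far part is infinite, so is the right side. Otherwise the upper bounds
   force the integral over B, and then the maximal function, to be finite. *)
case: (local_osc Om W eps x) => [d||]//; last first.
  move=> _ _ _ _ M0 _ _ _; rewrite [X in (_ <= _ + (_ * X))%E]gt0_muley ?lte_fin//.
  rewrite gt0_muley ?lte_fin// addey ?leey// -ltNye.
  by apply: lt_le_trans (ltNyr 0) _; rewrite adde_ge0// lee_fin.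
case: (Mfun alpha Om far_part x) => [M2||]//; last first.
  by move=> *; exact: leey.
case: (IB x) => [i||]; last 2 first.
- by move=> _ _; rewrite -EFinM -EFinD leye_eq.
- by [].
case: (Mmeas alpha Om W x) => [M||]; last 2 first.
- by rewrite -EFinM -EFinD leye_eq.
- by [].
rewrite -!EFinM -!EFinD !lee_fin => hU hL iU iL M0 MW0 I0 D0.
rewrite -powRN.
suff h : `|M - `|Om x| * enorm x `^ (- a) * m| <=
    M2 + eta * (m + 1) * (`|Om x| * enorm x `^ (- a)) +
    2 `^ a * (enorm x `^ (- a) * d) by exact: h.
have w0 : 0 <= w by rewrite fine_ge0.
have wc0 : 0 <= wc by rewrite fine_ge0.
apply: (real_comparison (i := i) (w := w) (u := (enorm x - eps) `^ (- a))
  (v := (enorm x + eps) `^ (- a))) => //; rewrite ?powR_ge0 ?(ltW eta0)//; try lra.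
- suff : 1 `^ a <= (2 : R) `^ a by rewrite powR1.
  by apply: ge0_ler_powR; rewrite ?nnegrE ?(ltW a0)// ler1n.
- by apply: powR_neg_le; rewrite ?(ltW a0)// lerDl ltW.
Qed.

End pointwise_comparison.

(** * Weak convergence of the dilates *)

Section weak_norm_theory.
Context (R : realType) (n : nat).
Notation Rn := (Rn R n.+1).
Notation leb := (@leb R n.+1).
Implicit Types x y z w : Rn.

Lemma weak_norm_elim (q c lam : R) (E : set Rn) (F : Rn -> \bar R) :
  0 < q -> 0 <= c -> 0 < lam -> (weak_norm q E F <= c%:E)%E ->
  (leb (E `&` [set x | (lam%:E < `|F x|)%E]) <= ((c / lam) `^ q)%:E)%E.
Proof.
move=> q0 c0 l0 h; set L := leb _.
have L0 : (0 <= L)%E by exact: leb_ge0.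
have h1 : (lam%:E * L `^ q^-1 <= c%:E)%E.
  by apply: le_trans h; apply: ereal_sup_ubound; exists lam.
have h2 : (L `^ q^-1 <= (c / lam)%:E)%E.
  by rewrite mulrC EFinM lee_pdivlMl.
have -> : L = ((L `^ q^-1) `^ q)%E.
  by rewrite -poweRrM mulVf ?gt_eqF// poweRe1.
rewrite -poweR_EFin; apply: gt0_ler_poweR; rewrite ?in_itv /= ?leey ?andbT ?poweR_ge0//.
  exact: ltW.
by rewrite lee_fin divr_ge0// ltW.
Qed.

Lemma weak_norm_intro (q c : R) (E : set Rn) (F : Rn -> \bar R) :
  0 < q -> 0 <= c ->
  (forall lam, 0 < lam ->
    (leb (E `&` [set x | (lam%:E < `|F x|)%E]) <= ((c / lam) `^ q)%:E)%E) ->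
  (weak_norm q E F <= c%:E)%E.
Proof.
move=> q0 c0 h; apply: ge_ereal_sup => _ [lam /= l0 <-].
have := h _ l0; set L := leb _ => hL.
have L0 : (0 <= L)%E by exact: leb_ge0.
have cl : 0 <= c / lam by rewrite divr_ge0// ltW.
have h2 : (L `^ q^-1 <= (c / lam)%:E)%E.
  rewrite [leRHS](_ : _ = (((c / lam) `^ q)%:E `^ q^-1)%E); last first.
    by rewrite poweR_EFin -powRrM mulfV ?gt_eqF// powRr1.
  apply: gt0_ler_poweR; rewrite ?in_itv /= ?leey ?andbT//.
    by rewrite invr_ge0 ltW.
  by rewrite lee_fin powR_ge0.
apply: le_trans (lee_wpmul2l _ h2) _; first by rewrite lee_fin ltW.
by rewrite -EFinM mulrC divfK// gt_eqF.
Qed.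

Lemma weak_norm_ge0 (q : R) (E : set Rn) (F : Rn -> \bar R) : (0 <= weak_norm q E F)%E.
Proof.
apply: (@le_trans _ _ (1%:E *
   (leb (E `&` [set x | (1%:E < `|F x|)%E]) `^ q^-1))%E).
  by rewrite mul1e poweR_ge0.
by apply: ereal_sup_ubound; exists 1 => /=.
Qed.

End weak_norm_theory.

(** * Dilated measures *)

Section dilations.
Context (R : realType) (n : nat).
Notation Rn := (Rn R n.+1).
Notation leb := (@leb R n.+1).
Implicit Types x y z w : Rn.

Lemma lebm_unit_mass k : exists2 Q, measurable Q & lebm (R := R) k Q = 1%E.
Proof.
elim: k => [|k [Q mQ Q1]].
  exists `[0, 1]%classic; first exact: measurable_itv.
  by rewrite /lebm /= lebesgue_measure_itv /= lte_fin ltr01 sube0.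
exists (Q `*` `[0, 1]%classic); first by apply: measurableX => //; exact: measurable_itv.
transitivity (lebm k Q * @lebesgue_measure R `[0%R, 1%R]%classic)%E.
  by apply: (@product_measure1E _ _ _ _ _ (lebm k) (@lebesgue_measure R)) => //.
by rewrite Q1 mul1e lebesgue_measure_itv /= lte_fin ltr01 sube0.
Qed.

Lemma leb_unit_mass : exists2 Q : set Rn, measurable Q & leb Q = 1%E.
Proof.
have [Q mQ Q1] := lebm_unit_mass n.
have e : @vec R n.+1 @^-1` (@unvec R n @^-1` Q) = Q.
  by apply/seteqP; split=> z /=; rewrite vecK.
exists (@unvec R n @^-1` Q); first by rewrite /measurable /= /Rn_measurable e.
by rewrite /Defs.leb /pushforward e.
Qed.

Variable V : {measure set Rn -> \bar R}.
Hypothesis Vfin : (V setT < +oo)%E.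

(** The dilate measures |x| >= eps as V measures |x| >= eps / t, so continuity from above along |x|
    >= k applies. *)
Lemma dilate_outside_small (eps s : R) : 0 < eps -> 0 < s ->
  exists2 t0 : R, 0 < t0 & forall t, 0 < t < t0 ->
    (dilate V t (~` eball (0%R : Rn) eps)%classic <= s%:E)%E.
Proof.
move=> e0 s0.
pose F (k : nat) := ~` eball (0 : Rn) k%:R.
have mF k : measurable (F k) by exact: measurable_outside.
have F0 : \bigcap_k F k = set0.
  apply/seteqP; split => // x h.
  have := archi_boundP (enorm_ge0 x); set K := Num.bound _ => hK.
  have := h K I; rewrite /F outside_eballE /= => h'.
  by have := le_lt_trans h' hK; rewrite ltxx.
have niF : nonincreasing_seq F.
  move=> j k jk; apply/subsetPset => x; rewrite /F !outside_eballE /=.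
  by apply: le_trans; rewrite ler_nat.
have VF : (V (F 0%N) < +oo)%E.
  by apply: le_lt_trans Vfin; apply: le_measure; rewrite ?inE.
have mI : measurable (\bigcap_n F n) by rewrite F0; exact: measurable0.
have := nonincreasing_cvg_mu VF mF mI niF.
rewrite F0 measure0 => cV.
have /(cV _) : nbhs (0 : \bar R)%E [set u | (u < s%:E)%E].
  by apply: open_ereal_lt'; rewrite lte_fin.
case=> k _ /(_ k (leqnn k)) /= hk.
(* For smaller t, eps / t exceeds k; the successor avoids division by zero. *)
exists (eps / k.+1%:R); first by rewrite divr_gt0.
move=> t /andP[t0 tk]; rewrite /dilate; apply: le_trans (ltW hk).
have -> : [set y | t *: y \in ~` eball (0 : Rn) eps] = ~` eball (0 : Rn) (eps / t).
  rewrite !outside_eballE; apply/seteqP; split => y /=;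
    by rewrite inE /= enormZ gtr0_norm// ler_pdivrMr// mulrC.
apply: le_measure; rewrite ?inE; [exact: measurable_outside|exact: mF|].
rewrite /F !outside_eballE => y /=; apply: le_trans.
rewrite ler_pdivlMr// ltr_pdivlMr// in tk *.
by apply: le_trans (ltW tk); rewrite mulrC ler_pM2l// ler_nat.
Qed.

(** [dilate] is a bare set function; identifying it with an image measure supplies the structure
    that Radon-Nikodym and Tonelli need. *)
Lemma dilate_finite_measure (t : R) :
  exists W : {finite_measure set Rn -> \bar R}, dilate V t = W.
Proof.
pose V' := image_measure V (@measurable_scale R n t).
have V'fin : (V' setT < +oo)%E by rewrite /V' /image_measure /pushforward preimage_setT.
exists (mfrestr measurableT V'fin); apply/funext => E.
rewrite /dilate /= /mfrestr /mrestr setIT /V' /image_measure /pushforward.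
by congr (V _); apply/seteqP; split => y /=; rewrite inE.
Qed.

Lemma dilate_setT (t : R) : dilate V t setT = V setT.
Proof. by rewrite /dilate; congr (V _); apply/seteqP; split => // y _ /=; rewrite inE. Qed.

Lemma dilate_dominates (t : R) : 0 < t -> V `<< leb -> dilate V t `<< leb.
Proof.
move=> t0 Vleb N Nnull A mA AN.
have mtA : measurable ((fun x => t *: x : Rn) @^-1` A).
  by rewrite -[X in measurable X]setTI; exact: measurable_scale.
have -> : dilate V t A = V ((fun x => t *: x : Rn) @^-1` A).
  by rewrite /dilate; congr (V _); apply/seteqP; split => y /=; rewrite inE.
have z : leb ((fun x => t *: x : Rn) @^-1` A) = 0%E.
  have := leb_scale t0 mA; rewrite (Nnull A mA AN) => /eqP.
  by rewrite mule_eq0 eqe expf_eq0 (gt_eqF t0) andbF /= => /eqP.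
apply: (Vleb ((fun x => t *: x : Rn) @^-1` A)) => // D mD Ds.
apply/eqP; rewrite eq_le measure_ge0 andbT -z.
by apply: le_measure; rewrite ?inE.
Qed.

End dilations.

Section weak_convergence.
Context (R : realType) (n : nat).
Notation Rn := (Rn R n.+1).
Notation leb := (@leb R n.+1).
Implicit Types x y z w : Rn.
Variables (alpha : R) (Om : Rn -> R).
Hypotheses (alpha_ge0 : 0 <= alpha) (alpha_lt : alpha < n.+1%:R).
Let a := n.+1%:R - alpha.
Let q := n.+1%:R / a.
Hypotheses (hOm : homogeneous0 Om) (hD : Lq_Dini q Om).

Let a0 : 0 < a. Proof. by rewrite subr_gt0. Qed.
Let q1 : 1 <= q.
Proof. by rewrite ler_pdivlMr// mul1r lerBlDr lerDl. Qed.
Let q0 : 0 < q. Proof. exact: lt_le_trans q1. Qed.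

Let mOm : measurable_fun setT Om.
Proof. by apply: measurable_homogeneous => //; case: hD => -[]. Qed.

(** The set whose infimum is [M_opnorm]. Estimates are proved for each of its members, so the
    infimum need not be attained. *)
Definition admissible (A : R) : Prop := 0 <= A /\
  forall f : Rn -> R, measurable_fun setT f -> (L1norm f < +oo)%E ->
    (weak_norm q setT (Mfun alpha Om f) <= A%:E * L1norm f)%E.

Variable A : R.
Hypothesis hA : admissible A.
Let A0 : 0 <= A. Proof. by case: hA. Qed.

(** Up to the factor n + 1, the q-th power of the sphere norm of Om. Only its finiteness matters,
    for making eta times the kernel small in weak L^q. *)
Let J : \bar R := (\int[leb]_(z in @pball R n) (`|Om (normalize z)| `^ q)%:E)%E.

Let J_ge0 : (0 <= J)%E.
Proof. by apply: integral_ge0 => z _; rewrite lee_fin powR_ge0. Qed.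

Let J_fin : J \is a fin_num.
Proof.
rewrite ge0_fin_numE//; case: hD => -[_ h] _; apply: le_lt_trans h.
rewrite /sph_int -[leLHS]mul1e; apply: lee_wpmul2r => //.
by rewrite lee_fin ler1n.
Qed.

Lemma Mmeas_weak (W : {finite_measure set Rn -> \bar R}) : W `<< leb ->
  (weak_norm q setT (Mmeas alpha Om W) <= A%:E * W setT)%E.
Proof.
move=> Wleb; have [f [mf f0 fE]] := density_exists Wleb.
rewrite (Mmeas_density alpha mOm f0 fE) -(L1norm_density f0 fE).
case: hA => _; apply => //; rewrite (L1norm_density f0 fE).
by rewrite ltey_eq fin_num_measure.
Qed.

(** Each of three pieces may use a third of the distribution bound, which costs a factor 3^(-1/q) on
    the norm. *)
Lemma third_powR (c delta lam : R) : 0 <= c -> 0 < delta -> 0 < lam ->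
  c <= delta * 3 `^ (- q^-1) -> (c / lam) `^ q <= (delta / lam) `^ q / 3.
Proof.
move=> c0 d0 l0 h.
have -> : (delta / lam) `^ q / 3 = (delta * 3 `^ (- q^-1) / lam) `^ q.
  rewrite mulrAC [RHS]powRM ?powR_ge0 ?divr_ge0 ?(ltW d0) ?(ltW l0)//.
  by rewrite -powRrM mulNr mulVf ?gt_eqF// powR_inv1.
apply: ge0_ler_powR; rewrite ?nnegrE ?(ltW q0)//.
- by rewrite divr_ge0// ltW.
- by rewrite divr_ge0 ?mulr_ge0 ?powR_ge0// ltW.
- by rewrite ler_pM2r ?invr_gt0.
Qed.

Lemma three_part_weak (E : set Rn) (F F1 F2 F3 : Rn -> \bar R) (c lam : R) :
  measurable E ->
  measurable_fun setT F -> measurable_fun setT F1 ->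
  measurable_fun setT F2 -> measurable_fun setT F3 ->
  (forall x, E x -> (F x <= F1 x + F2 x + F3 x)%E) ->
  (leb (E `&` [set x | ((lam / 3)%:E < F1 x)%E]) <= (c / 3)%:E)%E ->
  (leb (E `&` [set x | ((lam / 3)%:E < F2 x)%E]) <= (c / 3)%:E)%E ->
  (leb (E `&` [set x | ((lam / 3)%:E < F3 x)%E]) <= (c / 3)%:E)%E ->
  (leb (E `&` [set x | (lam%:E < F x)%E]) <= c%:E)%E.
Proof.
move=> mE mF mF1 mF2 mF3 FF h1 h2 h3.
have mS G l : measurable_fun setT G -> measurable (E `&` [set x | (l%:E < G x)%E]).
  by move=> mG; apply: emeasurable_fun_o_infty => //; exact: measurable_funTS.
set S1 := E `&` _ in h1; set S2 := E `&` _ in h2; set S3 := E `&` _ in h3.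
have m1 : measurable S1 by exact: mS.
have m2 : measurable S2 by exact: mS.
have m3 : measurable S3 by exact: mS.
apply: (@le_trans _ _ (leb (S1 `|` S2 `|` S3))).
  apply: le_measure; rewrite ?inE; [exact: mS|by do !apply: measurableU|].
  move=> x [Ex /= hx].
  have [n1|n1] := ltP (lam / 3)%:E (F1 x); first by left; left.
  have [n2|n2] := ltP (lam / 3)%:E (F2 x); first by left; right.
  have [n3|n3] := ltP (lam / 3)%:E (F3 x); first by right.
  have := lt_le_trans hx (le_trans (FF _ Ex) (leeD (leeD n1 n2) n3)).
  rewrite -!EFinD lte_fin => bad; exfalso.
  have e3 : lam / 3 + lam / 3 + lam / 3 = lam by field.
  by rewrite e3 ltxx in bad.
have m12 : measurable (S1 `|` S2) by exact: measurableU.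
apply: (le_trans (measureU2 _ m12 m3)).
apply: (@le_trans _ _ ((c / 3)%:E + (c / 3)%:E + (c / 3)%:E)%E).
  apply: leeD => //; apply: (le_trans (measureU2 _ m1 m2)).
  exact: leeD.
by rewrite -!EFinD lee_fin le_eqVlt; apply/orP; left; apply/eqP; field.
Qed.

Variable V : {measure set Rn -> \bar R}.
Hypotheses (Vfin : (V setT < +oo)%E) (Vleb : V `<< leb).

Lemma dilate_weak_small (rho delta : R) : 0 < rho -> 0 < delta ->
  exists2 t0 : R, 0 < t0 & forall t, 0 < t < t0 ->
  (weak_norm q (~` eball (0%R : Rn) rho)%classic
    (fun x => Mmeas alpha Om (dilate V t) x
       - (`|Om x| / enorm x `^ a)%:E * V setT) <= delta%:E)%E.
Proof.
move=> rho0 d0.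
pose m := fine (V setT); have m0 : 0 <= m by exact: fine_ge0.
(* M1 is the factor m + 1 of the pointwise comparison, and also a positive bound for the mass even
   if V vanishes. *)
pose M1 := m + 1; have M10 : 0 < M1 by rewrite ltr_wpDl.
pose j := fine J; have j0 : 0 <= j by exact: fine_ge0.
pose T := 3 `^ (- q^-1) : R; have T0 : 0 < T by rewrite powR_gt0.
(* Chosen so that b^q cancels the constant in the weak bound for the kernel; j + 1 is positive even
   if j = 0. *)
pose b := (2 ^+ n.+1 * (j + 1)) `^ (- q^-1).
have bj0 : 0 < 2 ^+ n.+1 * (j + 1) by rewrite mulr_gt0 ?exprn_gt0// ltr_wpDl.
have b0 : 0 < b by rewrite powR_gt0.
have bq : b `^ q = (2 ^+ n.+1 * (j + 1))^-1.
  by rewrite /b -powRrM mulNr mulVf ?gt_eqF// powR_inv1// ltW.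
pose eta := Num.min 1 (delta * T * b / (3 * M1)).
have eta0 : 0 < eta by rewrite lt_min ltr01 divr_gt0 ?mulr_gt0.
have eta1 : eta <= 1 by rewrite ge_min lexx.
have eta2 : 3 * (eta * M1) <= delta * T * b.
  by rewrite mulrCA -ler_pdivlMr ?mulr_gt0// ge_min lexx orbT.
(* The mass s left outside the small ball must be below eta for the pointwise comparison, and A s
   must be small for the weak bound on the far part. *)
pose s := Num.min eta (delta * T / (3 * (A + 1))).
have A10 : 0 < A + 1 by rewrite ltr_wpDl.
have s0 : 0 < s by rewrite lt_min eta0 divr_gt0 ?mulr_gt0.
have s1 : s <= eta by rewrite ge_min lexx.
have s2 : 3 * (A * s) <= delta * T.
  apply: (@le_trans _ _ (s * (3 * (A + 1)))).
    rewrite (_ : s * (3 * (A + 1)) = 3 * (A * s) + 3 * s); last by ring.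
    by rewrite lerDl mulr_ge0// ltW.
  by rewrite -ler_pdivlMr ?mulr_gt0// ge_min lexx orbT.
(* The factors are 3 from the splitting of the level, 2 from Chebyshev at half level, and 2^a from
   the pointwise comparison. *)
pose k3 : R := 6 * 2 `^ a; have k30 : 0 < k3 by rewrite mulr_gt0// powR_gt0.
pose et' := delta `^ q / (3 * (k3 `^ q * M1 `^ q)).
have et'0 : 0 < et'.
  by rewrite divr_gt0 ?powR_gt0// !mulr_gt0// powR_gt0.
have [d1 d10 hd1] := osc_tail q1 hOm mOm et'0 hD.
have [th /andP[th0 th1] hth] := powR_shift a0 eta0 eta1.
(* Proportional to rho: d1 serves the oscillation bound, and th gives eps <= th |x| for every |x| >=
   rho. *)
pose eps := Num.min d1 th * rho.
have eps0 : 0 < eps by rewrite mulr_gt0// lt_min d10.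
have [t0 t00 ht0] := dilate_outside_small Vfin eps0 s0.
exists t0 => // t /andP[tpos tt0].
have [W WE] := dilate_finite_measure Vfin t.
have Wleb : W `<< leb by rewrite -WE; exact: dilate_dominates.
have WT : W setT = V setT by rewrite -WE dilate_setT.
have WB : (W (~` eball (0%R : Rn) eps)%classic <= s%:E)%E.
  by rewrite -WE; apply: ht0; rewrite tpos.
have VT : V setT = m%:E by rewrite fineK// ge0_fin_numE.
rewrite WE -WT.
have [f [mf f0 fE]] := density_exists Wleb.
pose P := fun x => (`|Mmeas alpha Om W x - (`|Om x| / enorm x `^ a)%:E * W setT|)%E.
pose F1 := Mfun alpha Om (far_part f eps).
pose F2 := fun x => (eta * M1 * (`|Om x| / enorm x `^ a))%:E.
pose F3 := fun x => ((2 `^ a)%:E * ((enorm x `^ (- a))%:E * local_osc Om W eps x))%E.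
have mg : measurable_fun setT (fun x : Rn => `|Om x| / enorm x `^ a).
  apply: measurable_funM; first exact: measurableT_comp.
  apply: measurable_fun_invr; apply: (measurableT_comp (measurable_powR _)).
  exact: measurable_enorm.
have mP : measurable_fun setT P.
  apply: measurableT_comp => //; apply: emeasurable_funB.
    by rewrite (Mmeas_density alpha mOm f0 fE); exact: measurable_Mfun.
  rewrite WT VT; under eq_fun do rewrite -EFinM.
  by apply/measurable_EFinP; apply: measurable_funM.
have mF1 : measurable_fun setT F1.
  by apply: measurable_Mfun => //; exact: measurable_far_part.
have mF2 : measurable_fun setT F2.
  by apply/measurable_EFinP; apply: measurable_funM.
have mF3 : measurable_fun setT F3.
  apply: measurable_funeM; apply: emeasurable_funM.
    apply/measurable_EFinP/(measurableT_comp (measurable_powR _)).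
    exact: measurable_enorm.
  exact: measurable_local_osc.
have mE : measurable (~` eball (0%R : Rn) rho)%classic by exact: measurable_outside.
apply: weak_norm_intro => //; first exact: ltW.
move=> lam l0; have l30 : 0 < lam / 3 by rewrite divr_gt0.
apply: (three_part_weak (F1 := F1) (F2 := F2) (F3 := F3)) => //.
- move=> x; rewrite outside_eballE /= => hx.
  have x0 : 0 < enorm x by exact: lt_le_trans hx.
  have ex : eps <= th * enorm x.
    apply: (@le_trans _ _ (th * rho)); last by rewrite ler_pM2l.
    by rewrite ler_pM2r// ge_min lexx orbT.
  have [e1 u1 u2 v1] := hth _ _ x0 (ltW eps0) ex.
  have Mm : M1 = fine (W setT) + 1 by rewrite WT.
  rewrite /F1 /F2 /F3 Mm.
  apply: (pointwise_comparison alpha_lt mOm mf f0 fE eta0 eta1 eps0 e1 u1 u2 v1).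
  by apply: (le_trans WB); rewrite lee_fin.
- apply: (@le_trans _ _ ((A * s / (lam / 3)) `^ q)%:E).
    apply: (@le_trans _ _ (leb (setT `&` [set x | ((lam / 3)%:E < `|F1 x|)%E]))).
      apply: le_measure; rewrite ?inE.
      - by apply: emeasurable_fun_o_infty => //; exact: measurable_funTS.
      - by apply: emeasurable_fun_o_infty => //; exact: measurableT_comp.
      - move=> x [_ /= h]; split => //=; apply: (lt_le_trans h).
        exact: lee_abs.
    apply: weak_norm_elim => //; first by rewrite mulr_ge0// ltW.
    have L1 : (L1norm (far_part f eps) <= s%:E)%E.
      by rewrite (L1norm_far_part f0 fE).
    case: hA => _ /(_ (far_part f eps)) h.
    apply: le_trans (h _ _) _.
    + exact: measurable_far_part.
    + by apply: (le_lt_trans L1); rewrite ltry.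
    + by rewrite EFinM; apply: lee_wpmul2l; rewrite ?lee_fin.
  rewrite lee_fin (_ : A * s / (lam / 3) = 3 * (A * s) / lam); last first.
    by field; rewrite gt_eqF.
  apply: third_powR => //.
  by rewrite !mulr_ge0// ltW.
- pose kap := eta * M1; have kap0 : 0 < kap by rewrite mulr_gt0.
  have lk0 : 0 < lam / (3 * kap) by rewrite divr_gt0// mulr_gt0.
  apply: (@le_trans _ _ (leb [set x | (lam / (3 * kap) < `|kernel alpha Om x|)%R])).
    have mker : measurable_fun setT (kernel alpha Om) by exact: measurable_kernel_fun.
    apply: le_measure; rewrite ?inE.
    - by apply: emeasurable_fun_o_infty => //; exact: measurable_funTS.
    - by apply: measurable_pred; apply: measurable_fun_ltr => //; exact: measurableT_comp.
    - move=> x [_ /=]; rewrite /F2 lte_fin /kernel normrM normfV (ger0_norm (powR_ge0 _ _)).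
      rewrite -/kap ltr_pdivrMr// => h.
      rewrite ltr_pdivrMr ?mulr_gt0//; apply: (lt_le_trans h).
      by rewrite le_eqVlt; apply/orP; left; apply/eqP; move: (enorm x `^ a) => u; ring.
  apply: (le_trans (kernel_weak_le alpha_lt mOm hOm lk0)).
  rewrite -/q -/J -(fineK J_fin) -/j -!EFinM lee_fin.
  have -> : (lam / (3 * kap)) `^ (- q) = (3 * kap / lam) `^ q.
    rewrite -[in RHS]invf_div -[(lam / (3 * kap))^-1]powR_inv1 ?(ltW lk0)//.
    by rewrite -powRrM mulN1r.
  have hk : (3 * kap / lam) `^ q <= (delta / lam) `^ q / 3 * b `^ q.
    have -> : (delta / lam) `^ q / 3 * b `^ q = (delta * T * b / lam) `^ q.
      have dl : 0 <= delta / lam by rewrite divr_ge0// ltW.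
      have Tq : T `^ q = 3^-1.
        by rewrite /T -powRrM mulNr mulVf ?gt_eqF// powR_inv1.
      rewrite (_ : delta * T * b / lam = delta / lam * T * b); last by ring.
      rewrite [RHS]powRM ?(ltW b0) ?(mulr_ge0 dl (ltW T0))//.
      by rewrite [(delta / lam * T) `^ q]powRM ?(ltW T0)// Tq.
    have hx : 3 * kap / lam <= delta * T * b / lam by rewrite ler_pM2r ?invr_gt0.
    apply: (ge0_ler_powR (ltW q0) _ _ hx); rewrite nnegrE divr_ge0 ?(ltW l0)//.
      by rewrite mulr_ge0// ltW.
    by rewrite !mulr_ge0// ltW.
  apply: (@le_trans _ _ (2 ^+ n.+1 * ((delta / lam) `^ q / 3 * b `^ q * (j + 1)))).
    rewrite ler_pM2l ?exprn_gt0//; apply: ler_pM; rewrite ?powR_ge0// lerDl//.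
  rewrite bq (_ : 2 ^+ n.+1 * _ = (delta / lam) `^ q / 3)//.
  have jn : j + 1 != 0 by rewrite gt_eqF// ltr_wpDl.
  have pn : (2 : R) ^+ n.+1 != 0 by rewrite expf_neq0.
  move: (_ `^ q) (_ ^+ _) pn => u p pn.
  by field; rewrite jn pn.
- have t20 : 0 < (2 : R) `^ a by rewrite powR_gt0.
  have l2 : 0 < lam / (3 * 2 `^ a) by rewrite divr_gt0// mulr_gt0.
  have S3 : (~` eball (0%R : Rn) rho)%classic `&` [set x | ((lam / 3)%:E < F3 x)%E] =
     (~` eball (0%R : Rn) rho)%classic `&` [set x | ((lam / (3 * 2 `^ a))%:E <
        (enorm x `^ (- a))%:E * local_osc Om W eps x)%E].
    congr (_ `&` _); apply/seteqP; split => x /=;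
      by rewrite /F3 -[((lam / 3)%:E < (2 `^ a)%:E * _)%E]lte_pdivrMl// -EFinM
        [(2 `^ a)^-1 * _]mulrC -[lam / 3 / _]mulrA -invfM.
  rewrite S3.
  have WM1 : (W setT <= M1%:E)%E by rewrite WT VT lee_fin lerDl.
  have small y : eball (0%R : Rn) eps y ->
      (\int[leb]_(w in (~` eball (0%R : Rn) rho)%classic)
         (enorm w ^- n.+1 * osc q Om y w)%:E <= et'%:E)%E.
    rewrite /eball /= subr0 => hy; apply: hd1 => //; apply: (le_trans (ltW hy)).
    by rewrite ler_pM2r// ge_min lexx.
  apply: (le_trans (local_osc_weak alpha_ge0 alpha_lt mOm rho0 M10 WM1 (ltW et'0) small l2)).
  rewrite -/q lee_fin.
  have -> : 2 / (lam / (3 * 2 `^ a)) = k3 / lam.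
    rewrite /k3; move: (_ `^ a) t20 => u u0.
    by field; rewrite !gt_eqF.
  rewrite [(k3 / lam) `^ q]powRM ?invr_ge0 ?(ltW k30) ?(ltW l0)//.
  rewrite [(delta / lam) `^ q]powRM ?invr_ge0 ?(ltW d0) ?(ltW l0)// /et'.
  have kq : k3 `^ q != 0 by rewrite gt_eqF// powR_gt0.
  have mq : M1 `^ q != 0 by rewrite gt_eqF// powR_gt0.
  rewrite le_eqVlt; apply/orP; left; apply/eqP.
  move: (k3 `^ q) (M1 `^ q) (delta `^ q) (_ `^ q) kq mq => u1 u2 u3 u4 h1 h2.
  by field; rewrite h1 h2.
Qed.

End weak_convergence.

(** * Bounds for the kernel by the operator norm *)

Section kernel_bounds.
Context (R : realType) (n : nat).
Notation Rn := (Rn R n.+1).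
Notation leb := (@leb R n.+1).
Implicit Types x y z w : Rn.
Variables (alpha : R) (Om : Rn -> R).
Hypotheses (alpha_ge0 : 0 <= alpha) (alpha_lt : alpha < n.+1%:R).
Let a := n.+1%:R - alpha.
Let q := n.+1%:R / a.
Hypotheses (hOm : homogeneous0 Om) (hD : Lq_Dini q Om).
Let a0 : 0 < a. Proof. by rewrite subr_gt0. Qed.
Let q1 : 1 <= q.
Proof. by rewrite ler_pdivlMr// mul1r lerBlDr lerDl. Qed.
Let q0 : 0 < q. Proof. exact: lt_le_trans q1. Qed.
Let mOm : measurable_fun setT Om.
Proof. by apply: measurable_homogeneous => //; case: hD => -[]. Qed.

Variable A : R.
Hypothesis hA : admissible alpha Om A.
Let A0 : 0 <= A. Proof. by case: hA. Qed.

Let S (lam : R) : set Rn := [set x | lam < `|kernel alpha Om x|].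

Let mS lam : measurable (S lam).
Proof.
apply: measurable_pred; apply: measurable_fun_ltr => //.
by apply: measurableT_comp => //; exact: measurable_kernel_fun.
Qed.

Let kernel_normE x : `|kernel alpha Om x| = `|Om x| / enorm x `^ a.
Proof. by rewrite /kernel normrM normfV (ger0_norm (powR_ge0 _ _)). Qed.

(** Where the kernel exceeds lam, either the maximal function of the dilated unit mass exceeds lam /
    2, or it differs from the kernel by more than lam / 2. This halving is the origin of the
    constant 2 A. *)
Let outside_bound (rho lam e : R) : 0 < rho -> 0 < lam -> 0 < e ->
  (leb ((~` eball (0%R : Rn) rho) `&` S lam) <= ((2 * A / lam) `^ q)%:E + e%:E)%E.
Proof.
move=> rho0 l0 e0; have [Q mQ Q1] := leb_unit_mass R n.
pose V : {measure set Rn -> \bar R} := mrestr leb mQ.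
have VT : V setT = 1%E by rewrite /V /= /mrestr setTI.
have Vfin : (V setT < +oo)%E by rewrite VT ltry.
have Vleb : V `<< leb.
  move=> N Nnull B mB BN; rewrite /V /= /mrestr; apply: Nnull; first exact: measurableI.
  by move=> x [/BN].
have l20 : 0 < lam / 2 by rewrite divr_gt0.
(* Chosen so that (delta / (lam / 2))^q = e. *)
pose delta := lam / 2 * e `^ q^-1.
have d0 : 0 < delta by rewrite mulr_gt0// powR_gt0.
have [t0 t00 ht] := dilate_weak_small alpha_ge0 alpha_lt hOm hD hA Vfin Vleb rho0 d0.
pose t := t0 / 2.
have tp : 0 < t by rewrite divr_gt0.
have tt : 0 < t < t0 by rewrite tp /= ltr_pdivrMr// ltr_pMr// ltr1n.
have := ht t tt; have [W WE] := dilate_finite_measure Vfin t.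
have Wleb : W `<< leb by rewrite -WE; exact: dilate_dominates.
have WT : W setT = 1%E by rewrite -WE dilate_setT.
rewrite WE VT; under [X in weak_norm _ _ X]eq_fun do rewrite mule1.
set F := (X in weak_norm _ _ X) => hF.
have [f [mf f0 fE]] := density_exists Wleb.
have mM : measurable_fun setT (Mmeas alpha Om W).
  by rewrite (Mmeas_density alpha mOm f0 fE); exact: measurable_Mfun.
have mF : measurable_fun setT F.
  apply: emeasurable_funB => //; apply/measurable_EFinP.
  under eq_fun do rewrite -kernel_normE.
  by apply: measurableT_comp => //; exact: measurable_kernel_fun.
have b1 := weak_norm_elim q0 (ltW d0) l20 hF.
have hM : (weak_norm q setT (Mmeas alpha Om W) <= A%:E)%E.
  by rewrite -[leRHS]mule1 -WT; apply: Mmeas_weak => //.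
have b2 := weak_norm_elim q0 A0 l20 hM.
have mE : measurable (~` eball (0%R : Rn) rho)%classic by exact: measurable_outside.
set S1 := (X in (leb X <= _)%E) in b1; set S2 := (X in (leb X <= _)%E) in b2.
have mS1 : measurable S1.
  apply: emeasurable_fun_o_infty => //; apply: measurableT_comp => //.
  exact: measurable_funTS.
have mS2 : measurable S2.
  by apply: emeasurable_fun_o_infty => //; exact: measurableT_comp.
apply: (@le_trans _ _ (leb (S2 `|` S1))).
  apply: le_measure; rewrite ?inE; [exact: measurableI|exact: measurableU|].
  move=> x [Ex]; rewrite /S /= kernel_normE => hx.
  have [n2|n2] := ltP (lam / 2)%:E (`|Mmeas alpha Om W x|)%E; first by left.
  right; split => //=; rewrite ltNge; apply/negP; rewrite /F.
  move: n2; case: (Mmeas alpha Om W x) => [r||] //.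
  rewrite /= !lee_fin => r1 r2.
  move: hx r2; move: (_ / _) => g hx r2.
  have := ler_normB r (r - g); rewrite opprB addrCA subrr addr0 => h.
  have h' := ler_norm g.
  have : lam < lam / 2 + lam / 2.
    by apply: (lt_le_trans hx); apply: (le_trans h'); apply: (le_trans h); exact: lerD.
  by rewrite -splitr ltxx.
apply: (le_trans (measureU2 _ mS2 mS1)); apply: leeD.
  by apply: (le_trans b2); rewrite invf_div mulrCA mulrA.
apply: (le_trans b1); rewrite lee_fin /delta mulrAC mulfV ?gt_eqF// mul1r.
by rewrite -powRrM mulVf ?gt_eqF// powRr1// ltW.
Qed.

(** The bound outside B(0, rho) is uniform in rho, so continuity from below applies along rho = 1 /
    (k + 1); the origin is not lost, as the kernel is 0 there. *)
Lemma kernel_weak_admissible (lam : R) : 0 < lam ->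
  (leb [set x | (lam < `|kernel alpha Om x|)%R] <= ((2 * A / lam) `^ q)%:E)%E.
Proof.
move=> l0; rewrite -/(S lam).
pose F (k : nat) := (~` eball (0%R : Rn) k.+1%:R^-1) `&` S lam.
have mF k : measurable (F k).
  by apply: measurableI => //; exact: measurable_outside.
have FU : \bigcup_k F k = S lam.
  apply/seteqP; split => x; first by case=> k _ [].
  move=> Sx; have x0 : 0 < enorm x.
    rewrite enorm_gt0; apply: contraTneq Sx => ->; rewrite /S /= kernel_normE.
    by rewrite enorm0 powR0 ?gt_eqF// invr0 mulr0 -leNgt ltW.
  have x0' : 0 <= (enorm x)^-1 by rewrite invr_ge0 ltW.
  have := archi_boundP x0'; set K := Num.bound _ => hK.
  exists K => //; split => //; rewrite outside_eballE /=.
  rewrite -[leRHS]invrK lef_pV2 ?posrE ?invr_gt0// (le_trans (ltW hK))// ler_nat.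
  exact: leqnSn.
have ndF : nondecreasing_seq F.
  move=> j k jk; apply/subsetPset => x [Ex Sx]; split => //; move: Ex.
  rewrite !outside_eballE /=; apply: le_trans.
  by rewrite lef_pV2 ?posrE// ler_nat.
have mU : measurable (\bigcup_k F k) by rewrite FU.
have cv := @nondecreasing_cvg_mu _ _ R leb F mF mU ndF.
rewrite -FU -(cvg_lim _ cv)//; apply: lime_le; first by apply: cvgP cv.
apply: nearW => k /=; apply/lee_addgt0Pr => e e0.
by apply: outside_bound => //; rewrite invr_gt0.
Qed.

Lemma kernel_weak_norm :
  (weak_norm q setT (fun x => (Om x / enorm x `^ a)%:E) <= (2 * A)%:E)%E.
Proof.
apply: weak_norm_intro; [exact: q0|by rewrite mulr_ge0|] => lam l0.
apply: le_trans (kernel_weak_admissible l0).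
rewrite le_eqVlt; apply/orP; left; apply/eqP; rewrite setTI.
by congr (leb _); apply/seteqP; split => x /=; rewrite lte_fin.
Qed.

(** The factor n + 1 is the normalisation of [sph_int], and 2^(n+1) is the loss in the cone
    comparison at level 1. *)
Lemma sphere_norm_admissible :
  (Lq_sphere_norm q Om <= ((n.+1%:R * 2 ^+ n.+1) `^ q^-1 * (2 * A))%:E)%E.
Proof.
have A20 : 0 <= 2 * A by rewrite mulr_ge0.
have c0 : 0 <= n.+1%:R * 2 ^+ n.+1 :> R by rewrite mulr_ge0// exprn_ge0.
have S0 : (0 <= sph_int (fun y : Rn => (`|Om y| `^ q)%:E))%E.
  by apply: sph_int_ge0 => x; rewrite lee_fin powR_ge0.
rewrite /Lq_sphere_norm.
apply: (@le_trans _ _ ((n.+1%:R * 2 ^+ n.+1 * (2 * A) `^ q)%:E `^ q^-1)%E).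
  apply: gt0_ler_poweR; rewrite ?in_itv /= ?leey ?andbT//.
  - by rewrite invr_ge0 ltW.
  - by rewrite lee_fin mulr_ge0 ?powR_ge0.
  rewrite /sph_int -[X in (_ <= X%:E)%E]mulrA EFinM; apply: lee_wpmul2l => //.
  apply: (le_trans (kernel_weak_ge alpha_lt mOm hOm)).
  rewrite EFinM; apply: lee_wpmul2l; first by rewrite lee_fin exprn_ge0.
  by apply: (le_trans (kernel_weak_admissible ltr01)); rewrite divr1.
rewrite poweR_EFin lee_fin powRM ?powR_ge0//.
by rewrite -[(2 * A) `^ q `^ _]powRrM mulfV ?gt_eqF// powRr1.
Qed.

End kernel_bounds.

(** * From admissible bounds to the operator norm *)

Unset Implicit Arguments.

Theorem theorem1p6 (R : realType) (n : nat) (alpha : R) :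
  (0 < n)%N -> 0 <= alpha -> alpha < n%:R ->
  exists C : R, 0 < C /\
  forall (Om : Rn R n -> R) (V : {measure set (Rn R n) -> \bar R}),
    homogeneous0 Om ->
    Lq_Dini (n%:R / (n%:R - alpha)) Om ->
    (V setT < +oo)%E ->
    V `<< @leb R n ->
    (M_opnorm alpha Om < +oo)%E ->
    [/\
      (* (1) *)
      (weak_norm (n%:R / (n%:R - alpha)) setT
         (fun x => (Om x / enorm x `^ (n%:R - alpha))%:E) < +oo)%E /\
      (weak_norm (n%:R / (n%:R - alpha)) setT
         (fun x => (Om x / enorm x `^ (n%:R - alpha))%:E)
         <= C%:E * M_opnorm alpha Om)%E,
      (* (2) *)
      in_Lq_sphere (n%:R / (n%:R - alpha)) Om /\
      (Lq_sphere_norm (n%:R / (n%:R - alpha)) Om <= C%:E * M_opnorm alpha Om)%E &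
      (* (3) *)
      forall rho : R, 0 < rho ->
        (weak_norm (n%:R / (n%:R - alpha)) (~` eball 0 rho)
           (fun x => (Mmeas alpha Om (dilate V t) x
                      - (`|Om x| / enorm x `^ (n%:R - alpha))%:E * V setT)%E))
          @[t --> 0^'+] --> 0%E].
Proof.
case: n => [//|n] _ al0 aln.
pose q : R := n.+1%:R / (n.+1%:R - alpha).
(* The constant of the sphere bound. Since K >= 1, the value 2 K also serves for (1), where 2 would
   do. *)
pose K : R := (n.+1%:R * 2 ^+ n.+1) `^ q^-1.
have q0 : 0 < q by rewrite divr_gt0// subr_gt0.
have K1 : 1 <= K.
  suff : 1 `^ q^-1 <= K by rewrite powR1.
  apply: ge0_ler_powR; rewrite ?invr_ge0 ?(ltW q0) ?nnegrE ?mulr_ge0 ?exprn_ge0//.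
  by rewrite -natrX -natrM ler1n muln_gt0 expn_gt0.
have K0 : 0 < K by exact: lt_le_trans K1.
exists (2 * K); split; first by rewrite mulr_gt0.
move=> Om V hOm hD Vfin Vleb opfin.
have [A hA] : exists A, admissible alpha Om A.
  have [_ [A hA _] _] := ereal_inf_lt opfin.
  by exists A.
(* Dividing by c > 0 makes w / c a lower bound of the admissible constants, hence at most their
   infimum. *)
have le_opnorm (w : \bar R) (c : R) : 0 < c ->
    (forall A, admissible alpha Om A -> (w <= (c * A)%:E)%E) ->
    (w <= c%:E * M_opnorm alpha Om)%E.
  move=> c0 h; rewrite -lee_pdivrMl//; apply: le_ereal_inf_tmp => _ [B hB <-].
  by rewrite lee_pdivrMl// -EFinM; exact: h.
have op0 : (0 <= M_opnorm alpha Om)%E.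
  by apply: le_ereal_inf_tmp => _ [B [B0 _] <-]; rewrite lee_fin.
split.
- split.
    by apply: (le_lt_trans (kernel_weak_norm al0 aln hOm hD hA)); rewrite ltry.
  apply: (@le_trans _ _ (2%:E * M_opnorm alpha Om)%E).
    by apply: le_opnorm => // B hB; exact: kernel_weak_norm.
  by apply: lee_wpmul2r => //; rewrite lee_fin ler_peMr.
- split; first by case: hD.
  apply: le_opnorm; first by rewrite mulr_gt0.
  move=> B hB; rewrite [2 * K]mulrC -mulrA.
  exact: (sphere_norm_admissible al0 aln hOm hD hB).
- move=> rho rho0 U [e /= e0 eU].
  (* Halving e turns the weak inequality into the strict one that defines the neighbourhood. *)
  have e20 : 0 < e / 2 by rewrite divr_gt0.
  have [t0 t00 ht] := dilate_weak_small al0 aln hOm hD hA Vfin Vleb rho0 e20.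
  apply: (@filterS _ (0 : R)^'+ _ [set t | 0 < t < t0]); last first.
    near=> t; apply/andP; split; near: t; first exact: nbhs_right_gt.
    exact: nbhs_right_lt.
  move=> t /ht h /=.
  have := weak_norm_ge0 q (~` eball (0 : Rn R n.+1) rho)
    (fun x => Mmeas alpha Om (dilate V t) x
       - (`|Om x| / enorm x `^ (n.+1%:R - alpha))%:E * V setT)%E.
  move: h; rewrite -/q; set w := weak_norm _ _ _.
  case: w => [r||] //; rewrite !lee_fin => re r0.
  apply: eU; rewrite /= distrC subr0 ger0_norm//.
  by apply: (le_lt_trans re); rewrite ltr_pdivrMr// ltr_pMr// ltr1n.
Unshelve. all: by end_near.
Qed.
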